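(* For every integer $n \geq 2$, there is a bijection between the set of 3-connected planar linear normal $\lambda$-terms with $n$ variables (i.e. $n$ atoms) and the set of rooted bipartite planar maps with $n-2$ edges.
   Context: $\lambda$-terms are built from atoms (variables), applications $t\,u$ and abstractions $\lambda x.t$ (which bind the not-yet-bound atoms $x$ in $t$), considered up to $\alpha$-renaming. A term is linear if it is closed and each abstraction binds exactly one atom; it is (β-)normal if it has no sub-term of the form $(\lambda x.u)\,v$. The skeleton $\operatorname{Sk}(t)$ is the plane unary-binary tree defined by: an atom gives a leaf; an application $u\,v$ gives a binary node with left subtree $\operatorname{Sk}(u)$ and right subtree $\operatorname{Sk}(v)$; an abstraction $\lambda x.u$ gives a unary node with only subtree $\operatorname{Sk}(u)$. The number of variables (size) of $t$ is the number of leaves of $\operatorname{Sk}(t)$. The diagram $\operatorname{Diag}(t)$ is the graph obtained from $\operatorname{Sk}(t)$ by replacing each leaf by an edge from the leaf's parent to the unary node of the abstraction binding that atom; this edge is drawn starting from the parent of the leaf, travelling counter-clockwise, and entering the unary node from the right. The term $t$ is planar if all these edges can be drawn without crossings (for linear terms: reading unary nodes and leaves by first visit in the clockwise contour walk of the skeleton from the root gives a well-parenthesized word, unary nodes as opening and leaves as closing parentheses, each abstraction matched with the atom it binds). A term $t$ is 3-connected if removing any two edges of $\operatorname{Diag}(t)$ does not disconnect $\operatorname{Diag}(t)$, except possibly the pair of two edges adjacent to the root of $\operatorname{Sk}(t)$ when $t$ starts with an abstraction binding one atom. A rooted planar map is a planar map (graph embedded in the plane, up to orientation-preserving deformation) with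 a marked corner on the outer face (root corner), whose vertex is the root vertex; the empty map is a single vertex. A planar map is bipartite if its vertices can be colored black and white so that every edge joins a black and a white vertex. *)

(* Defs.v *)
From mathcomp Require Import all_boot all_fingroup.
From Stdlib Require Import Relation_Operators.

Set Implicit Arguments.
Unset Strict Implicit.
Unset Printing Implicit Defensive.

(* Lambda terms, with de Bruijn indices (so alpha-equivalence = equality).  *)
(* Var i refers to the i-th enclosing abstraction (0 = innermost).          *)
Inductive lterm : Type :=
| Var : nat -> lterm
| App : lterm -> lterm -> lterm
| Lam : lterm -> lterm.

Fixpoint closed_at (d : nat) (t : lterm) : bool :=
  match t with
  | Var i => i < d
  | App u v => closed_at d u && closed_at d v
  | Lam b => closed_at d.+1 b
  end.

Fixpoint occ (k : nat) (t : lterm) : nat :=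
  match t with
  | Var i => (i == k)
  | App u v => occ k u + occ k v
  | Lam b => occ k.+1 b
  end.

Fixpoint binds_one (t : lterm) : bool :=
  match t with
  | Var _ => true
  | App u v => binds_one u && binds_one v
  | Lam b => (occ 0 b == 1) && binds_one b
  end.

Definition linear (t : lterm) : bool := closed_at 0 t && binds_one t.

Fixpoint normal (t : lterm) : bool :=
  match t with
  | Var _ => true
  | App (Lam _) _ => false
  | App u v => normal u && normal v
  | Lam b => normal b
  end.

Fixpoint nvars (t : lterm) : nat :=
  match t with
  | Var _ => 1
  | App u v => nvars u + nvars v
  | Lam b => nvars b
  end.

(* Tokens: an abstraction (opening) or an atom (closing), each labelled by  *)
(* the identifier of the abstraction concerned (for an atom: its binder).   *)
Inductive token := Open of nat | Close of nat.

(* Clockwise contour walk from the root of the skeleton (root on top):     *)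
(* for a binary node the RIGHT subtree is visited before the left one.     *)
(* env = identifiers of the enclosing abstractions (innermost first),      *)
(* c = next fresh identifier. Returns the word and the next identifier.    *)
Fixpoint contour (t : lterm) (env : seq nat) (c : nat) : seq token * nat :=
  match t with
  | Var i => ([:: Close (nth 0 env i)], c)
  | Lam b => let (w, c') := contour b (c :: env) c.+1 in (Open c :: w, c')
  | App u v =>
      let (w1, c1) := contour v env c in
      let (w2, c2) := contour u env c1 in (w1 ++ w2, c2)
  end.

Fixpoint wellpar (w : seq token) (st : seq nat) : bool :=
  match w with
  | [::] => st == [::]
  | Open a :: w' => wellpar w' (a :: st)
  | Close a :: w' =>
      match st with
      | [::] => false
      | b :: st' => (a == b) && wellpar w' st'
      end
  end.

Definition planar (t : lterm) : bool := wellpar (contour t [::] 0).1 [::].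

(* Nodes of Sk(t) are named by their path from the root (0 = left/only     *)
(* child, 1 = right child). Vertices of Diag(t) = internal nodes.          *)
Fixpoint inodes (t : lterm) (p : seq nat) : seq (seq nat) :=
  match t with
  | Var _ => [::]
  | Lam b => p :: inodes b (rcons p 0)
  | App u v => p :: (inodes u (rcons p 0) ++ inodes v (rcons p 1))
  end.

(* the edge of Diag(t) for the child c (in direction d) of node p:          *)
(* skeleton edge if c is internal, or the edge from p to the binder of the  *)
(* atom if c is a leaf. env' = binder paths seen from c (innermost first).  *)
Definition child_edge (p : seq nat) (d : nat) (c : lterm) (env' : seq (seq nat))
  : seq (seq nat * seq nat) :=
  match c with
  | Var i => [:: (p, nth [::] env' i)]
  | _ => [:: (p, rcons p d)]
  end.

Fixpoint dedges (t : lterm) (p : seq nat) (env : seq (seq nat))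
  : seq (seq nat * seq nat) :=
  match t with
  | Var _ => [::]
  | Lam b => child_edge p 0 b (p :: env) ++ dedges b (rcons p 0) (p :: env)
  | App u v =>
      child_edge p 0 u env ++ child_edge p 1 v env
      ++ dedges u (rcons p 0) env ++ dedges v (rcons p 1) env
  end.

Definition diag_vertices (t : lterm) := inodes t [::].
Definition diag_edges (t : lterm) := dedges t [::] [::].

Definition adj_minus (t : lterm) (i j : nat) (x y : seq nat) : Prop :=
  exists k, [/\ k < size (diag_edges t), k != i, k != j &
    (nth ([::], [::]) (diag_edges t) k == (x, y)) ||
    (nth ([::], [::]) (diag_edges t) k == (y, x))].

Definition connected_minus (t : lterm) (i j : nat) : Prop :=
  forall x y, x \in diag_vertices t -> y \in diag_vertices t ->
    clos_refl_trans (seq nat) (adj_minus t i j) x y.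

Definition exceptional_pair (t : lterm) (i j : nat) : bool :=
  match t with
  | Lam b =>
      (occ 0 b == 1) &&
      ([::] \in [:: (nth ([::], [::]) (diag_edges t) i).1;
                   (nth ([::], [::]) (diag_edges t) i).2]) &&
      ([::] \in [:: (nth ([::], [::]) (diag_edges t) j).1;
                   (nth ([::], [::]) (diag_edges t) j).2])
  | _ => false
  end.

Definition three_connected (t : lterm) : Prop :=
  forall i j, i < size (diag_edges t) -> j < size (diag_edges t) -> i != j ->
    ~~ exceptional_pair t i j -> connected_minus t i j.

Definition good_term (n : nat) (t : lterm) : Prop :=
  [/\ linear t, normal t, planar t, three_connected t & nvars t = n].

(* Rooted planar maps with k edges, as combinatorial maps on the 2k darts:  *)
(* sigma = rotation around vertices, alpha = edge involution; the root     *)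
(* corner is given by a root dart (None only for the empty map, k = 0).     *)
Record rmap (k : nat) := RMap {
  msigma : {perm 'I_(k.*2)};
  malpha : {perm 'I_(k.*2)};
  mroot  : option 'I_(k.*2) }.

Definition map_rel k (M : rmap k) : rel 'I_(k.*2) :=
  fun x y => (y == msigma M x) || (y == malpha M x).

Definition is_rooted_map k (M : rmap k) : Prop :=
  [/\ forall d, malpha M (malpha M d) = d,
      forall d, malpha M d != d,
      (mroot M == None) = (k == 0) &
      forall d d', connect (map_rel M) d d'].

(* Euler's formula V - E + F = 2 (the empty map is planar by convention) *)
Definition is_planar_map k (M : rmap k) : bool :=
  (k == 0) ||
  (#|porbits (msigma M)| + #|porbits (malpha M * msigma M)%g| == k + 2).

(* vertices (sigma-orbits) 2-coloured so that each edge joins two colours *)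
Definition is_bipartite_map k (M : rmap k) : Prop :=
  exists c : 'I_(k.*2) -> bool,
    forall d, c (msigma M d) = c d /\ c (malpha M d) != c d.

Definition rooted_bipartite_planar_map k (M : rmap k) : Prop :=
  [/\ is_rooted_map M, is_planar_map M & is_bipartite_map M].

Definition rmap_iso k (M N : rmap k) : Prop :=
  exists psi : {perm 'I_(k.*2)},
    [/\ forall d, psi (msigma M d) = msigma N (psi d),
        forall d, psi (malpha M d) = malpha N (psi d) &
        omap psi (mroot M) = mroot N].

(* Main.v *)
Require Import Defs.
From mathcomp Require Import all_boot all_fingroup.
From mathcomp Require Import zify.
From Stdlib Require Import Relation_Operators ClassicalEpsilon.

(* A 3-connected planar linear normal term with at least two atoms has the form
   \x1 ... xa y. x1 v, where v takes its free atoms from the abstractions above it.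
   A 2-edge cut of the diagram isolates either a subterm with a single free atom, or
   the abstractions and the argument v of a subterm \x1 ... xa. u v with a free atoms
   in v; hence v ranges over the terms all of whose subterms \x1 ... xa. u v have more
   than a free atoms in v. On the side of maps, deleting the root edge leaves either
   two maps or one map with a chosen corner of its root face. Both families are
   encoded by the same trees, the number of free atoms of a term minus one being half
   the degree of the root face.

   A bipartite map is handled as a pair of permutations (a, b) of its edges, the
   rotations around black and white vertices. Deleting an edge multiplies a and b by
   transpositions, which makes the change in the number of cycles of a, b and a * b
   explicit; the components are counted by the invariant boolean functions. This
   yields Euler's inequality, and planarity then tells whether the deletion
   disconnects the map. *)

Set Implicit Arguments.
Unset Strict Implicit.
Unset Printing Implicit Defensive.

(** * Planar linear terms *)

(** By normality the operator [u] of [\x1 ... xa. u v] is a head variable applied to arguments,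
    hence a left spine of [Br] nodes. The abstractions are recorded at the bottom of that spine, as
    a [Ch] node over the tree of [v] with label [j = exc v - a], so that [a < exc v] becomes the
    range [1 <= j <= bdeg] of the admissible corners. A subterm with m atoms has a tree with m - 1
    edges, and the head variable of the closed term takes one more atom: hence n - 2. Deleting an
    edge changes the number of darts and of components. All hypermaps therefore live on one fixed
    type, deleted darts being fixed points, and [rep] treats a list of rooted components at once.
    Since labels are arbitrary, it is a relation, and the correspondence splits into four facts:
    every valid tree is realised, every planar hypermap has a tree, this tree is unique, and
    hypermaps with the same tree are isomorphic. *)

(* Free de Bruijn indices in the order of the contour walk. *)
Fixpoint fvs (t : lterm) : seq nat :=
  match t with
  | Var i => [:: i]
  | App u v => fvs v ++ fvs u
  | Lam b => [seq i.-1 | i <- fvs b & 0 < i]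
  end.

Definition exc t := size (fvs t).

(* Every abstraction binds exactly the first free atom of its body. *)
Fixpoint pl (t : lterm) : bool :=
  match t with
  | Var _ => true
  | App u v => pl u && pl v
  | Lam b => pl b && (fvs b == 0 :: map S (fvs (Lam b)))
  end.

Lemma pl_Lam b : pl (Lam b) -> pl b /\ fvs b = 0 :: map S (fvs (Lam b)).
Proof. by case/andP=> ? /eqP. Qed.

Lemma pl_LamI b l : pl b -> fvs b = 0 :: map S l -> pl (Lam b) /\ fvs (Lam b) = l.
Proof.
move=> plb Eb.
suff El : fvs (Lam b) = l.
  split=> //; change (pl b && (fvs b == 0 :: map S (fvs (Lam b)))).
  by rewrite plb El Eb eqxx.
rewrite /= Eb /= (all_filterP _) ?all_map; first exact: (mapK (f := S) (g := predn)).
by apply/allP.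
Qed.

Lemma count_fvs k t : count_mem k (fvs t) = occ k t.
Proof.
elim: t k => [i|u IHu v IHv|b IHb] k /=.
- by rewrite addn0.
- by rewrite count_cat IHu IHv addnC.
- rewrite count_map count_filter -IHb; apply: eq_count => -[|i]; by rewrite /= ?ltnn ?andbF ?andbT.
Qed.

Lemma closed_at_fvs d t : closed_at d t = all (gtn d) (fvs t).
Proof.
elim: t d => [i|u IHu v IHv|b IHb] d /=; first by rewrite andbT.
  by rewrite all_cat IHu IHv andbC.
rewrite all_map all_filter IHb; apply: eq_all => -[|i] //=.
Qed.

Lemma contour_leq t env c : c <= (contour t env c).2.
Proof.
elim: t env c => [i|u IHu v IHv|b IHb] env c //=.
  case E1: (contour v env c) => [w1 c1]; case E2: (contour u env c1) => [w2 c2] /=.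
  by have := IHv env c; have := IHu env c1; rewrite E1 E2 /=; lia.
by case E1: (contour b _ _) => [w1 c1] /=; have := IHb (c :: env) c.+1; rewrite E1 /=; lia.
Qed.

(** Reading [t] pops one identifier of [st] per free atom, in the order of [fvs t]; its own
    abstractions are pushed and popped in between. The arbitrary continuation and stack make the two
    branches of an application compose, and [env] below [c] keeps the fresh identifier distinct from
    the enclosing ones. *)
Lemma contour_wellpar t env c w st :
  closed_at (size env) t -> binds_one t -> all (gtn c) env ->
  wellpar ((contour t env c).1 ++ w) st =
  [&& pl t, take (exc t) st == map (nth 0 env) (fvs t)
    & wellpar w (drop (exc t) st)].
Proof.
elim: t env c w st => [i|u IHu v IHv|b IHb] env c w st /=.
- move=> _ _ _; case: st => [|b st] //=.
  by rewrite take0 drop0 eqseq_cons eqxx andbT eq_sym.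
- case/andP=> cu cv /andP[bu bv] envc.
  case E1: (contour v env c) => [w1 c1]; case E2: (contour u env c1) => [w2 c2] /=.
  have lec : c <= c1 by have := contour_leq v env c; rewrite E1.
  have envc1 : all (gtn c1) env by apply: sub_all envc => x /=; lia.
  have := IHv env c (w2 ++ w) st cv bv envc; rewrite E1 /= -catA => ->.
  have := IHu env c1 w (drop (exc v) st) cu bu envc1; rewrite E2 /= => ->.
  have -> : exc (App u v) = exc v + exc u by rewrite /exc /= size_cat.
  rewrite takeD drop_drop [exc u + _]addnC map_cat.
  case: (leqP (exc v) (size st)) => [lest|gtst].
    rewrite eqseq_cat ?size_map ?size_takel //.
    by do !case: (_ == _) => //=; case: (pl u); case: (pl v).
  (* The stack is too short for [v]: both sides are false by comparison of lengths. *)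
  have -> : (take (exc v) st == map (nth 0 env) (fvs v)) = false.
    by apply/eqP=> /(congr1 size) E; move: gtst; rewrite /exc -(size_map (nth 0 env) (fvs v)) -E size_take_min ltnNge geq_minr.
  rewrite andbF; case: eqP => [/(congr1 size)|]; rewrite ?andbF //.
  rewrite -takeD size_cat !size_map size_take_min -/(exc u) -/(exc v). move=> E.
  have := geq_minr (exc v + exc u) (size st); rewrite E => /(leq_trans (leq_addr _ _)).
  by rewrite leqNgt gtst.
- move=> cb /andP[/eqP oc bb] envc.
  case E1: (contour b _ _) => [w1 c1] /=.
  have := IHb (c :: env) c.+1 w (c :: st) cb bb; rewrite E1 /= => ->; last first.
    by rewrite leqnn; apply: sub_all envc => x /=; lia.
  move: oc cb; rewrite -count_fvs closed_at_fvs /exc /=.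
  case: (fvs b) => [|i l] //= oc /andP[ile _].
  rewrite eqseq_cons.
  (* If the first free atom had another binder, the identifier [c] on top of the stack would occur
     in [env], whose entries are below [c]. *)
  case: i oc ile => [|i] /=; last first.
    move=> _ ile; rewrite andbF; case: eqP => [Ec|]; rewrite ?andbF //.
    move/allP/(_ (nth 0 env i)): envc; rewrite mem_nth; last exact: ile.
    by move/(_ isT); rewrite -Ec /= ltnn.
  rewrite eqxx /= => -[oc] _.
  have al : all (leq 1) l.
    apply/allP=> -[|x] // xin; move/eqP: oc; rewrite eqn0Ngt -has_count.
    by case/hasP; exists 0.
  rewrite (all_filterP al) size_map -map_comp.
  have -> : map (S \o predn) l = l.
    by rewrite -[RHS]map_id; apply/eq_in_map => x /(allP al) /=; lia.
  rewrite eqxx andbT; congr [&& _, _ == _ & _].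
  rewrite -map_comp; apply/eq_in_map => x /(allP al) /=; by case: x.
Qed.

Lemma linear_planarP t : linear t && planar t = (fvs t == [::]) && pl t.
Proof.
rewrite /linear /planar; apply/andP/andP => [[/andP[ct bt]]|[/eqP ft plt]].
  have := @contour_wellpar t [::] 0 [::] [::] ct bt isT.
  rewrite cats0 => -> /and3P[-> _ _]; move: ct; rewrite closed_at_fvs.
  by case: (fvs t).
have ct : closed_at 0 t by rewrite closed_at_fvs ft.
have bt : binds_one t.
  elim: t plt {ft ct} => [i|u IHu v IHv|b IHb] //=; first by case/andP=> /IHu-> /IHv->.
  case/andP=> /IHb->; rewrite -count_fvs => /eqP ->; rewrite /= andbT.
  by rewrite add1n eqSS eqn0Ngt -has_count -all_predC all_map; apply/allP.
split; first by rewrite ct bt.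
by have := @contour_wellpar t [::] 0 [::] [::] ct bt isT; rewrite cats0 => ->; rewrite plt /exc ft.
Qed.

(** The innermost abstraction, of index 0, binds the first atom of the walk, the next one the second
    atom, and so on: hence the initial segment [iota 0 a]. *)
Lemma fvs_iter_Lam a m : pl (iter a Lam m) ->
  pl m /\ fvs m = iota 0 a ++ map (addn a) (fvs (iter a Lam m)).
Proof.
elim: a m => [|a IHa] m; first by move=> ->; rewrite /= (eq_map add0n) map_id.
rewrite iterSr => /IHa[/pl_Lam[plm ->] ->]; split=> //.
rewrite map_cat -(iotaDl 1) -map_comp /=; congr (_ :: _).
Qed.

Lemma iter_LamI a m l : pl m -> fvs m = iota 0 a ++ map (addn a) l ->
  pl (iter a Lam m) /\ fvs (iter a Lam m) = l.
Proof.
elim: a m => [|a IHa] m; first by move=> plm ->; rewrite /= (eq_map add0n) map_id.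
move=> plm Em; rewrite iterSr.
have /(pl_LamI plm)[] : fvs m = 0 :: map S (iota 0 a ++ map (addn a) l).
  by rewrite Em map_cat -(iotaDl 1) -map_comp.
by move=> pll El; apply: IHa.
Qed.

Lemma exc_Lam b : pl (Lam b) -> exc b = (exc (Lam b)).+1.
Proof. by case/pl_Lam=> _ E; rewrite /exc E /= !size_map. Qed.

Lemma exc_App u v : exc (App u v) = exc v + exc u.
Proof. by rewrite /exc size_cat. Qed.

Lemma exc_iter_Lam a m : pl (iter a Lam m) -> exc m = a + exc (iter a Lam m).
Proof. by case/fvs_iter_Lam=> _ E; rewrite /exc E size_cat size_iota size_map. Qed.

Definition neutral u := if u is Lam _ then false else true.

(* [a] counts the abstractions directly above [t]. *)
Fixpoint good (a : nat) (t : lterm) : bool :=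
  match t with
  | Var _ => a == 0
  | Lam b => good a.+1 b
  | App u v => [&& a < exc v, neutral u, good 0 u & good 0 v]
  end.

(** In a closed planar term the abstractions at the top outnumber the free atoms of the argument, so
    the inequality of [good] always fails there; requiring the operator to be a variable replaces
    it. *)
Fixpoint topgood (t : lterm) : bool :=
  match t with
  | Lam b => topgood b
  | App (Var _) v => good 0 v
  | _ => false
  end.

(** * Cuts of the diagram *)

Section Colouring.

Variable f : seq nat -> bool.

Definition broken (e : seq nat * seq nat) := f e.1 != f e.2.
Definition br t p env := count broken (dedges t p env).

(* A leaf is identified with the abstraction binding it. *)
Definition kap t p env := if t is Var i then f (nth [::] env i) else f p.
Definition eps t env := [seq f (nth [::] env i) | i <- fvs t].

Lemma br_child p d c env :
  count broken (child_edge p d c env) = (f p != kap c (rcons p d) env).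
Proof. by case: c => [i|u v|b] /=; rewrite addn0. Qed.

Lemma br_App u v p env : br (App u v) p env =
  (f p != kap u (rcons p 0) env) + (f p != kap v (rcons p 1) env)
  + (br u (rcons p 0) env + br v (rcons p 1) env).
Proof. by rewrite /br /= !count_cat !br_child !addnA. Qed.

Lemma br_Lam b p env : br (Lam b) p env =
  (f p != kap b (rcons p 0) (p :: env)) + br b (rcons p 0) (p :: env).
Proof. by rewrite /br /= count_cat br_child. Qed.

Lemma eps_App u v env : eps (App u v) env = eps v env ++ eps u env.
Proof. by rewrite /eps map_cat. Qed.

Lemma eps_Lam b p env : pl (Lam b) -> eps b (p :: env) = f p :: eps (Lam b) env.
Proof. by case/pl_Lam=> _ E; rewrite /eps E /= -map_comp. Qed.

Lemma size_eps t env : size (eps t env) = exc t.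
Proof. by rewrite size_map. Qed.

Lemma mono_unbroken s p env : pl s -> br s p env = 0 ->
  all (pred1 (kap s p env)) (eps s env)
  /\ all (fun q => f q == kap s p env) (inodes s p).
Proof.
elim: s p env => [i|u IHu v IHv|b IHb] p env.
- by rewrite /eps /= eqxx.
- rewrite /= br_App => /andP[plu plv].
  case: eqP => //= Ku; case: eqP => //= Kv; rewrite !add0n => /eqP.
  rewrite addn_eq0 => /andP[/eqP bu /eqP bv].
  have [] := IHu _ _ plu bu; have [] := IHv _ _ plv bv.
  rewrite eps_App !all_cat -Ku -Kv => -> -> -> ->; by rewrite eqxx.
- move=> plb; rewrite br_Lam; case: eqP => //= Kb bb.
  have [] := IHb _ _ (proj1 (pl_Lam plb)) bb; rewrite -Kb (eps_Lam _ _ plb) /= eqxx /=.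
  by move=> -> ->.
Qed.

(* Number of colour changes along the walk from a node of colour [x] up
   through nodes coloured [cs] to one of colour [y]. *)
Fixpoint changes (x : bool) cs y : nat :=
  if cs is c :: cs' then (x != c) + changes c cs' y else x != y.

Lemma changes_neq x cs y : (x != y) <= changes x cs y.
Proof.
elim: cs x => [|c cs IH] x //=; have := IH c.
by move: (changes c cs y) => m {IH}; case: x; case: c; case: y => //=; lia.
Qed.

Lemma changes_odd x cs y : odd (changes x cs y) = (x != y).
Proof.
elim: cs x => [|c cs IH] x /=; first by rewrite oddb.
by rewrite oddD IH oddb {IH}; case: x; case: c; case: y.
Qed.

Lemma changes_mono x cs : all (pred1 x) cs -> changes x cs x = 0.
Proof. by elim: cs => [|c cs IH] /=; rewrite ?eqxx // => /andP[/eqP-> /IH ->]; rewrite eqxx. Qed.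

Lemma changes0 x cs y : changes x cs y = 0 -> x = y /\ all (pred1 y) cs.
Proof.
elim: cs x => [|c cs IH] x /=; first by case: eqP.
by case: eqP => //= -> /IH[-> ->]; rewrite eqxx.
Qed.

(** All that lies outside the block made of [s] and its [a] abstractions is seen as one vertex of
    colour [k]: the parent and the binders of the other [m] free atoms. [changes] counts the broken
    edges along the abstractions, so the block has no proper cut of at most two edges. *)
Lemma good_unbroken a s p env cs m k :
  good a s -> pl s -> size cs = a -> eps s env = cs ++ nseq m k ->
  changes (kap s p env) cs k + br s p env <= 2 ->
  br s p env = 0 /\ changes (kap s p env) cs k = 0.
Proof.
elim: s a p env cs m => [i|u IHu v IHv|b IHb] a p env cs m.
- move=> /= /eqP -> _ /size0nil -> /=; rewrite /eps /=.
  by case: m => [|[|m]] //= [->]; rewrite eqxx.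
- case/and4P=> av nu gu gv /andP[plu plv] szcs; rewrite eps_App => E.
  (* As [a < exc v], all atoms bound by the block lie in [v], which keeps [exc v - a > 0] atoms
     bound outside. *)
  have [m1 [m1_gt0 Ev Eu]] : exists m1,
      [/\ 0 < m1, eps v env = cs ++ nseq m1 k & eps u env = nseq (exc u) k].
    have : take (exc v) (cs ++ nseq m k) ++ drop (exc v) (cs ++ nseq m k)
           = eps v env ++ eps u env by rewrite cat_take_drop.
    have szm : a + m = exc v + exc u.
      by rewrite -szcs -(size_nseq m k) -size_cat -E size_cat !size_eps.
    move/eqP; rewrite eqseq_cat; last first.
      by rewrite size_takel ?size_eps // size_cat size_nseq szcs szm leq_addr.
    case/andP=> /eqP <- /eqP <-; exists (exc v - a); split; first by rewrite subn_gt0.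
      by rewrite take_cat szcs ltnNge (ltnW av) /= take_nseq //; lia.
    by rewrite drop_cat szcs ltnNge (ltnW av) /= drop_nseq; congr nseq; lia.
  rewrite br_App [kap (App u v) p env]/=.
  set ku := kap u _ _; set kv := kap v _ _ => le2.
  have chk := changes_neq (f p) cs k.
  (* Triangle inequality through [p]: a colour change from [u] to the outside is paid for by the
     edge to [u] or by the walk up from [p]. *)
  have [bu /= cu] : br u (rcons p 0) env = 0 /\ changes ku [::] k = 0.
    apply: (IHu 0 _ _ [::] (exc u)) => //=; rewrite -/ku.
    apply: leq_trans le2; move: chk; clear.
    by case: (f p); case: (ku); case: (k); case: (kv) => /=; lia.
  have {cu} Ku : ku = k by apply/eqP; case: (ku == k) cu.
  rewrite bu Ku /= in le2 *.
  have vmono : br v (rcons p 1) env = 0 -> kv = k /\ all (pred1 k) cs.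
    move=> bv; have [+ _] := mono_unbroken plv bv; rewrite -/kv Ev all_cat all_nseq.
    by rewrite eqn0Ngt m1_gt0 /= => /andP[+ /eqP Ek]; rewrite -Ek.
  case: (eqVneq (changes (f p) cs k) 0) => [ch0|chn0].
    have [fpk csk] := changes0 ch0; rewrite ch0 fpk eqxx /= in le2 *.
    have [bv /= cv] : br v (rcons p 1) env = 0 /\ changes kv [::] k = 0.
      apply: (IHv 0 _ _ [::] (exc v)) => //=; last by rewrite -/kv [kv == k]eq_sym.
      rewrite /= -(size_eps v env); apply/all_pred1P.
      by rewrite Ev all_cat csk all_nseq /= eqxx orbT.
    by rewrite bv; case: eqP cv => //= ->; rewrite eqxx.
  (* Some edge of the walk up is broken. If [p] has colour [k] there are two by parity; otherwise
     the edge from [p] to [u] is the second one. Either way [v] is unbroken, and its atom bound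
     outside gives it the colour [k], a contradiction. *)
  case: (eqVneq (f p) k) => [fpk|fpk].
    rewrite fpk eqxx /= in le2 chn0 *.
    have bv : br v (rcons p 1) env = 0.
      move: le2 chn0 (changes_odd k cs k); rewrite eqxx /=.
      by move: (_ != kv) (changes _ _ _) (br _ _ _) => x y z; clear; lia.
    have [_ csk] := vmono bv; by rewrite changes_mono ?eqxx in chn0.
  rewrite fpk /= in le2.
  have bv : br v (rcons p 1) env = 0.
    move: le2 chn0; move: (_ != kv) (changes _ _ _) (br _ _ _) => x y z.
    by clear; lia.
  have [Kv _] := vmono bv; exfalso; move: le2 chn0; rewrite Kv fpk bv /=.
  by move: (changes _ _ _) => x; clear; lia.
- move=> /= gb plb szcs E; rewrite br_Lam => le2.
  have := IHb a.+1 (rcons p 0) (p :: env) (f p :: cs) m gb (proj1 (pl_Lam plb)).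
  rewrite (eps_Lam _ _ plb) E /= szcs => /(_ erefl erefl).
  move: le2; rewrite [_ == f p]eq_sym.
  by move: (_ != _) (changes _ _ _) (br _ _ _) => x y z; clear; lia.
Qed.

(** The head variable is the last atom of the walk, so [r] is the colour of its binder, which in the
    application is the root. At most two broken edges leave all other vertices on one side, and
    isolating the root costs two edges. *)
Lemma topgood_unbroken s p env cs r :
  topgood s -> pl s -> eps s env = rcons cs r ->
  changes (kap s p env) cs r + br s p env <= 2 ->
  exists k, [/\ all (fun q => f q == k) (inodes s p), all (pred1 k) cs &
    k != r -> 2 <= changes (kap s p env) cs r + br s p env].
Proof.
elim: s p env cs => [i|u _ v IHv|b IHb] p env cs //.
- case: u => // i gv /andP[_ plv].
  rewrite eps_App /eps /= cats1 => /rcons_inj[Ev Ei].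
  rewrite br_App /= Ei; have -> : br (Var i) (rcons p 0) env = 0 by [].
  set kv := kap v _ _ => le2; have chk := changes_neq (f p) cs r.
  have odc := changes_odd (f p) cs r; exists (f p).
  have vmono : br v (rcons p 1) env = 0 ->
      all (pred1 kv) cs /\ all (fun q => f q == kv) (inodes v (rcons p 1)).
    by move=> bv; have := mono_unbroken plv bv; rewrite /eps Ev.
  case: (eqVneq (f p) r) => [fpr|fpr]; last first.
    have [bv /eqP Kv] : br v (rcons p 1) env = 0 /\ f p == kv.
      move: chk le2; rewrite fpr /=; case: (f p == kv);
        by move: (changes _ _ _) (br _ _ _) => x y; clear; lia.
    have [csk vk] := vmono bv; rewrite /= eqxx /= Kv; split=> // _.
    rewrite Kv in chk fpr; rewrite fpr in chk; have {}chk : 0 < changes kv cs r := chk.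
    by rewrite -addnA addnCA add1n ltnS addn_gt0 chk.
  rewrite fpr eqxx /= in le2 odc *.
  case: (eqVneq (changes r cs r) 0) => [ch0|chn0].
    have [_ csr] := changes0 ch0.
    have [bv /= cv] : br v (rcons p 1) env = 0 /\ changes kv [::] r = 0.
      apply: (@good_unbroken 0 _ _ _ [::] (exc v)) => //=.
        by rewrite -(size_eps v env); apply/all_pred1P; rewrite /eps Ev.
      by rewrite -/kv [kv == r]eq_sym; move: le2; rewrite ch0.
    have [_] := vmono bv; have -> : kv = r by apply/eqP; case: eqP cv.
    by rewrite /= eqxx => ->.
  have [bv /eqP Kv] : br v (rcons p 1) env = 0 /\ r == kv.
    move: le2 chn0 odc; case: (r == kv);
      by move: (changes _ _ _) (br _ _ _) => x y; clear; lia.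
  by have [csr _] := vmono bv; rewrite -Kv in csr; rewrite changes_mono in chn0.
- move=> /= gb plb E; rewrite br_Lam => le2.
  have := IHb (rcons p 0) (p :: env) (f p :: cs) gb (proj1 (pl_Lam plb)).
  rewrite (eps_Lam _ _ plb) E /= => /(_ erefl).
  rewrite [_ == f p]eq_sym.
  case.
    by move: le2; move: (_ != _) (changes _ _ _) (br _ _ _) => x y z; clear; lia.
  move=> k [kb /= /andP[/eqP fpk csk] k2]; exists k; split=> //.
    by rewrite fpk eqxx.
  by move/k2; move: (_ != _) (changes _ _ _) (br _ _ _) => x y z; clear; lia.
Qed.

End Colouring.

(** A cut is given by positions in the list of edges, so broken edges are counted by positions
    too. *)
Lemma count_index T (x0 : T) (P : pred T) s (ks : seq nat) :
  (forall k, k < size s -> P (nth x0 s k) -> k \in ks) -> count P s <= size ks.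
Proof.
move=> sub; rewrite -[s in count P s](mkseq_nth x0) /mkseq count_map -size_filter.
apply: uniq_leq_size => [|k]; first by rewrite filter_uniq ?iota_uniq.
by rewrite mem_filter mem_iota /= => /andP[Pk ks']; apply: sub.
Qed.

Lemma child_edge_nodes p d c env L :
  closed_at (size env) c -> p \in L -> {subset inodes c (rcons p d) <= L} ->
  all (fun e => (e.1 \in L) && (e.2 \in L ++ env)) (child_edge p d c env).
Proof.
case: c => [i|u v|b] /= cl pL sub; rewrite pL mem_cat ?andbT.
- by rewrite mem_nth ?orbT.
- by rewrite sub ?inE ?eqxx.
- by rewrite sub ?inE ?eqxx.
Qed.

Lemma dedges_nodes t p env : closed_at (size env) t ->
  all (fun e => (e.1 \in inodes t p) && (e.2 \in inodes t p ++ env)) (dedges t p env).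
Proof.
elim: t p env => [i|u IHu v IHv|b IHb] p env //= => [/andP[cu cv]|cb]; rewrite !all_cat.
- rewrite !child_edge_nodes ?inE ?eqxx //=; first last.
  + by move=> x; rewrite inE mem_cat => ->; rewrite orbT.
  + by move=> x; rewrite inE mem_cat => ->; rewrite !orbT.
  apply/andP; split.
    by apply: sub_all (IHu (rcons p 0) env cu) => e /andP[];
      rewrite !inE !mem_cat => -> /orP[] ->; rewrite ?orbT.
  by apply: sub_all (IHv (rcons p 1) env cv) => e /andP[];
      rewrite !inE !mem_cat => -> /orP[] ->; rewrite ?orbT.
- have sub : {subset inodes b (rcons p 0) <= p :: inodes b (rcons p 0)}.
    by move=> x; rewrite inE => ->; rewrite orbT.
  apply/andP; split.
    have := @child_edge_nodes p 0 b (p :: env) _ cb (mem_head _ _) sub.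
    by apply: sub_all => e; rewrite /= !(inE, mem_cat) => /andP[-> /or4P[]] -> ; rewrite ?orbT.
  apply: sub_all (IHb (rcons p 0) (p :: env) cb) => e /andP[].
  by rewrite !(inE, mem_cat) => -> /or3P[] ->; rewrite ?orbT.
Qed.

(** Colour the vertices by reachability from [x] after the removal of the edges [i] and [j], the
    only ones that can be broken. If the colouring is not constant it isolates the root, both
    removed edges touch the root, and the pair is the exceptional one. *)
Lemma topgood_three_connected t :
  topgood t -> pl t -> fvs t = [::] -> three_connected t.
Proof.
case: t => [|u v|b] //.
  by case: u => // i _ _ /(congr1 size); rewrite size_cat /= addn1.
move=> gt plt ft i j lti ltj neij nexc x y xin yin.
set t := Lam b in gt plt ft lti ltj nexc xin yin *.
pose R := clos_refl_trans (seq nat) (adj_minus t i j).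
pose f q := if excluded_middle_informative (R x q) then true else false.
have fP q : reflect (R x q) (f q).
  by rewrite /f; case: excluded_middle_informative => H; constructor.
have fx : f x by apply/fP; apply: rt_refl.
suff fxy : f x = f y by apply/fP; rewrite -fxy.
have unbr k : k < size (diag_edges t) ->
    broken f (nth ([::], [::]) (diag_edges t) k) -> k \in [:: i; j].
  move=> ltk; apply: contraLR; rewrite !inE negb_or => /andP[ki kj].
  have step : forall u v, (nth ([::], [::]) (diag_edges t) k == (u, v)) ||
      (nth ([::], [::]) (diag_edges t) k == (v, u)) -> f u -> f v.
    move=> u v uv /fP Rxu; apply/fP; apply: rt_trans Rxu _; apply: rt_step.
    by exists k; split.
  rewrite /broken negbK; move: step; case: (nth _ _ _) => u v step /=.
  by apply/eqP; apply/idP/idP => H; apply: step H; rewrite !eqxx ?orbT.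
have le2 : br f t [::] [::] <= 2 by apply: (count_index unbr).
have Eb : eps f b [:: [::]] = rcons [::] (f [::]) by rewrite (eps_Lam f _ _ plt) /eps ft.
have Ebr : br f t [::] [::] = changes (kap f b [:: 0] [:: [::]]) [::] (f [::])
    + br f b [:: 0] [:: [::]] by rewrite br_Lam /= [f _ == _]eq_sym.
have [|k [bk _ k2]] := @topgood_unbroken f b [:: 0] [:: [::]] [::] (f [::]) gt
  (proj1 (pl_Lam plt)) Eb; first by rewrite -Ebr.
rewrite -Ebr in k2.
case: (eqVneq k (f [::])) => [Ek|nk].
  have all_k : all (fun q => f q == k) (diag_vertices t) by rewrite /= -Ek eqxx.
  by rewrite (eqP (allP all_k _ xin)) (eqP (allP all_k _ yin)).
have {k2} := k2 nk => ge2; case/negP: nexc.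
have brk l l' : l \in [:: i; j] -> [:: i; j] =i [:: l; l'] -> l != l' ->
    broken f (nth ([::], [::]) (diag_edges t) l).
  move=> _ ijl nl; case nbr: (broken _ _) => //; move: ge2; rewrite ltnNge => /negP[].
  apply: (@count_index _ ([::], [::]) _ _ [:: l']) => m ltm bm.
  by have := unbr m ltm bm; rewrite ijl !inE => /orP[/eqP mE|//]; rewrite mE nbr in bm.
have inc l : l < size (diag_edges t) -> broken f (nth ([::], [::]) (diag_edges t) l) ->
  [::] \in [:: (nth ([::], [::]) (diag_edges t) l).1; (nth ([::], [::]) (diag_edges t) l).2].
  move=> ltl; apply: contraLR; rewrite !inE negb_or => /andP[n1 n2]; rewrite /broken negbK.
  have ct : closed_at (size (@nil (seq nat))) t by rewrite closed_at_fvs ft.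
  have := allP (dedges_nodes [::] ct) _ (mem_nth ([::], [::]) ltl).
  rewrite !(inE, mem_cat) orbF eq_sym (negPf n1) [_ == [::]]eq_sym (negPf n2) /=.
  by case/andP=> /(allP bk) /eqP -> /(allP bk) /eqP ->.
have oc : occ 0 b == 1 by have [_ E] := pl_Lam plt; rewrite -count_fvs E ft.
rewrite /exceptional_pair /t oc !inc //.
  apply: (brk j i); rewrite ?inE ?eqxx ?orbT 1?eq_sym // => m.
  by rewrite !inE orbC.
by apply: (brk i j); rewrite ?inE ?eqxx.
Qed.

(** * From 3-connectedness to the inequalities on free atoms *)

Definition nonleaf s := if s is Var _ then false else true.

(* [occurs t p env s q e]: when [t] sits at node [p] below the binders [env],
   its subterm [s] sits at node [q] below the binders [e]. *)
Inductive occurs : lterm -> seq nat -> seq (seq nat) ->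
    lterm -> seq nat -> seq (seq nat) -> Prop :=
| occurs_refl t p env : occurs t p env t p env
| occurs_Lam b p env s q e :
    occurs b (rcons p 0) (p :: env) s q e -> occurs (Lam b) p env s q e
| occurs_left u v p env s q e :
    occurs u (rcons p 0) env s q e -> occurs (App u v) p env s q e
| occurs_right u v p env s q e :
    occurs v (rcons p 1) env s q e -> occurs (App u v) p env s q e.

Lemma occurs_trans t1 p1 e1 t2 p2 e2 t3 p3 e3 :
  occurs t1 p1 e1 t2 p2 e2 -> occurs t2 p2 e2 t3 p3 e3 -> occurs t1 p1 e1 t3 p3 e3.
Proof. by move=> o12 o23; elim: o12 o23 => *; [|constructor 2|constructor 3|constructor 4]; auto. Qed.

Lemma occurs_pl t p env s q e : occurs t p env s q e -> pl t -> pl s.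
Proof.
elim=> [//|??????? IH /pl_Lam[/IH]|???????? IH /andP[/IH]|???????? IH /andP[_ /IH]] //.
Qed.

Lemma normal_App u v : Defs.normal (App u v) -> [/\ neutral u, Defs.normal u & Defs.normal v].
Proof. by case: u => [i|u1 u2|b] //= /andP[]. Qed.

Lemma occurs_normal t p env s q e :
  occurs t p env s q e -> Defs.normal t -> Defs.normal s.
Proof.
by elim=> // u v ?????? IH /normal_App[_ nu nv]; apply: IH.
Qed.

Lemma prefix_sibling (p z : seq nat) d d' :
  prefix (rcons p d) z -> prefix (rcons p d') z -> d = d'.
Proof.
by rewrite !prefixE !size_rcons => /eqP -> /eqP /rcons_inj[].
Qed.

Lemma occurs_prefix t p env s q e : occurs t p env s q e -> prefix p q.
Proof.
elim=> [*|b {}p {}env {}s {}q {}e _ IH|u v {}p {}env {}s {}q {}e _ IH|u v {}p {}env {}s {}q {}e _ IH];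
  first exact: prefix_refl; exact: prefix_trans (prefix_rcons _ _) IH.
Qed.

Lemma occurs_env t p env s q e : occurs t p env s q e ->
  all (fun z => size z < size p) env -> all (fun z => size z < size q) e.
Proof.
have W (l : seq (seq nat)) (p0 : seq nat) d :
    all (fun z => size z < size p0) l -> all (fun z => size z < size (rcons p0 d)) l.
  by apply: sub_all => z; rewrite size_rcons; exact: leqW.
elim=> // [b {}p {}env {}s {}q {}e _ IH|u v {}p {}env {}s {}q {}e _ IH|u v {}p {}env {}s {}q {}e _ IH] H;
  by apply: IH; rewrite /= ?W // size_rcons leqnn.
Qed.

Lemma occurs_inode t p env s q e :
  occurs t p env s q e -> nonleaf s -> q \in inodes t p.
Proof.
elim=> [{}t {}p ?|b {}p ????? IH|u v {}p ????? IH|u v {}p ????? IH] H /=.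
- by case: t H => //= *; rewrite inE eqxx.
- by rewrite inE IH ?orbT.
- by rewrite inE mem_cat IH ?orbT.
- by rewrite inE mem_cat IH ?orbT.
Qed.

Lemma occurs_edge t p env s q e :
  occurs t p env s q e -> nonleaf s ->
  q = p \/ exists q0 d, q = rcons q0 d /\ (q0, q) \in dedges t p env.
Proof.
elim=> [{}t {}p {}env|b {}p {}env {}s {}q {}e o IH|u v {}p {}env {}s {}q {}e o IH|u v {}p {}env {}s {}q {}e o IH] ns.
- by left.
- right; case: (IH ns) => [Eq|[q0 [d [Eq E]]]]; last first.
    by exists q0, d; split=> //=; rewrite mem_cat E orbT.
  exists p, 0; split=> //=; rewrite mem_cat Eq.
  case: b o {IH} => [i|? ?|?] o /=; rewrite ?inE ?eqxx //.
  by inversion o; subst.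
- right; case: (IH ns) => [Eq|[q0 [d [Eq E]]]]; last first.
    by exists q0, d; split=> //=; rewrite !mem_cat E !orbT.
  exists p, 0; split=> //=; rewrite mem_cat Eq.
  case: u o {IH} => [i|? ?|?] o /=; rewrite ?inE ?eqxx //.
  by inversion o; subst.
- right; case: (IH ns) => [Eq|[q0 [d [Eq E]]]]; last first.
    by exists q0, d; split=> //=; rewrite !mem_cat E !orbT.
  exists p, 1; split=> //=; rewrite !mem_cat Eq.
  case: v o {IH} => [i|? ?|?] o /=; rewrite ?inE ?eqxx ?orbT //.
  by inversion o; subst.
Qed.

Section CutColouring.

Variable f : seq nat -> bool.

(** With [s] on one side, only edges from its free atoms to their binders can be broken. The summand
    with [kap] is nonzero only for a leaf, whose edge is listed with its parent. *)
Lemma br_const (k : bool) s p env :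
  pl s -> (forall z, prefix p z -> f z = k) ->
  (k != kap f s p env) + br f s p env = count (fun i => k != f (nth [::] env i)) (fvs s).
Proof.
elim: s p env => [i|u IHu v IHv|b IHb] p env.
- by rewrite /= /br /= addn0.
- case/andP=> plu plv H; rewrite br_App /= !(H p) ?prefix_refl // eqxx add0n.
  have Hd d z : prefix (rcons p d) z -> f z = k.
    by move=> pz; apply: H; apply: prefix_trans pz; apply: prefix_rcons.
  rewrite count_cat -(IHu (rcons p 0)) //; last exact: Hd.
  by rewrite -(IHv (rcons p 1)) //; [rewrite addnACA addnC | exact: Hd].
- move=> plb H; rewrite br_Lam [kap f (Lam b) p env]/= H ?prefix_refl // eqxx add0n.
  have [plb' E] := pl_Lam plb; rewrite IHb //.
    by rewrite E /= H ?prefix_refl // eqxx add0n count_map.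
  by move=> z pz; apply: H; apply: prefix_trans pz; apply: prefix_rcons.
Qed.

Lemma br_false s p env :
  pl s -> (forall z, prefix p z -> f z = false) -> f [::] = false ->
  (forall z, z \in env -> f z = false) -> kap f s p env = false /\ br f s p env = 0.
Proof.
move=> pls fp f0 fenv; have := br_const env pls fp.
rewrite (_ : count _ _ = 0).
  by case: (kap _ _ _ _).
apply/eqP; rewrite eqn0Ngt -has_count -all_predC; apply/allP => i _ /=.
rewrite negbK eq_sym; case: (ltnP i (size env)) => ilt; first by rewrite fenv ?mem_nth.
by rewrite nth_default ?f0.
Qed.

(** Outside [s] and the edge entering [q], all edges have both ends uncoloured: sibling subterms are
    not below [q], and binders above [q] have shorter paths. The last summand is the edge entering
    [q], not listed in [t] when [q = p]. *)
Lemma br_occurs t p env s q e :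
  occurs t p env s q e -> pl t -> nonleaf s ->
  f [::] = false -> (forall z, f z -> prefix q z) ->
  all (fun z => size z < size p) env ->
  br f t p env = br f s q e + (if q == p then 0 else f q).
Proof.
move=> o plt ns f0 fq; have lt1 z : size z < size q -> f z = false.
  by move=> ltz; apply/negP=> /fq/size_prefix; rewrite leqNgt ltz.
have child c p0 d env0 : occurs c (rcons p0 d) env0 s q e ->
    br f c (rcons p0 d) env0 = br f s q e + (if q == rcons p0 d then 0 else f q) ->
    (f p0 != kap f c (rcons p0 d) env0) + br f c (rcons p0 d) env0
    = br f s q e + (if q == p0 then 0 else f q).
  move=> oc ->; have /prefixP[l El] := occurs_prefix oc.
  have -> : q == p0 = false.
    by apply/eqP=> E; move/(congr1 size): El; rewrite E size_cat size_rcons; lia.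
  rewrite lt1; last by rewrite El size_cat size_rcons; lia.
  case: l El => [|x l] El.
    rewrite cats0 in El; rewrite El eqxx addn0.
    suff -> : kap f c (rcons p0 d) env0 = f (rcons p0 d) by case: (f _); lia.
    by case: c oc => // i oc; inversion oc; subst.
  have -> : q == rcons p0 d = false.
    by apply/eqP=> E; move/(congr1 size): El; rewrite E size_cat /=; lia.
  suff -> : kap f c (rcons p0 d) env0 = false by [].
  case: c oc => [i|? ?|?] oc; last 2 first.
  - by apply: lt1; rewrite El size_cat /=; lia.
  - by apply: lt1; rewrite El size_cat /=; lia.
  by inversion oc; subst.
have sib c p0 d d' env0 : pl c -> d != d' -> prefix (rcons p0 d) q ->
    all (fun z => size z < size p0) env0 ->
    kap f c (rcons p0 d') env0 = false /\ br f c (rcons p0 d') env0 = 0.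
  move=> plc dd' pq lenv; apply: br_false => // z.
    move=> pz; apply/negP=> /fq/(prefix_trans pq)/prefix_sibling/(_ pz) E.
    by rewrite E eqxx in dd'.
  move/(allP lenv) => ltz; apply: lt1; have := size_prefix pq.
  by rewrite size_rcons; apply: ltn_trans.
elim: o plt {f0} ns fq lt1 child sib => {t p env s q e}
  [t p env|b p env s q e o IH|u v p env s q e o IH|u v p env s q e o IH]
  plt ns fq lt1 child sib lenv.
- by rewrite eqxx addn0.
- rewrite br_Lam; apply: (child _ _ _ _ o); apply: IH => //; first by case/pl_Lam: plt.
  by rewrite /= size_rcons leqnn; apply: sub_all lenv => z; exact: leqW.
- have lenv' d : all (fun z => size z < size (rcons p d)) env.
    by rewrite size_rcons; apply: sub_all lenv => z; exact: leqW.
  case/andP: plt => plu plv; have pq := occurs_prefix o.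
  have [kv bv] := sib v p 0 1 env plv isT pq lenv.
  rewrite br_App kv bv -(child _ _ _ _ o) ?IH // lt1; first by lia.
  by have := size_prefix pq; rewrite size_rcons.
- have lenv' d : all (fun z => size z < size (rcons p d)) env.
    by rewrite size_rcons; apply: sub_all lenv => z; exact: leqW.
  case/andP: plt => plu plv; have pq := occurs_prefix o.
  have [kv bv] := sib u p 1 0 env plu isT pq lenv.
  rewrite br_App kv bv -(child _ _ _ _ o) ?IH // lt1; first by lia.
  by have := size_prefix pq; rewrite size_rcons.
Qed.

End CutColouring.

(** The broken edge [e0] away from the root prevents the pair of removed edges from being the
    exceptional one, and the colour is constant along all the edges that remain. *)
Lemma cut_const t (f : seq nat -> bool) e0 x y :
  three_connected t -> 2 <= size (diag_edges t) -> br f t [::] [::] <= 2 ->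
  e0 \in diag_edges t -> broken f e0 -> e0.1 != [::] -> e0.2 != [::] ->
  x \in diag_vertices t -> y \in diag_vertices t -> f x = f y.
Proof.
move=> tc sz le2 e0in be0 n1 n2 xin yin.
pose d0 := (@nil nat, @nil nat).
pose B := [seq k <- iota 0 (size (diag_edges t)) | broken f (nth d0 (diag_edges t) k)].
have szB : size B <= 2.
  apply: leq_trans le2; rewrite /br -/(diag_edges t).
  by rewrite -[s in count _ s](mkseq_nth d0) /mkseq count_map size_filter.
have uB : uniq B by rewrite filter_uniq ?iota_uniq.
set k0 := index e0 (diag_edges t).
have lt0 : k0 < size (diag_edges t) by rewrite index_mem.
have nth0 : nth d0 (diag_edges t) k0 = e0 by rewrite nth_index.
have k0B : k0 \in B by rewrite mem_filter mem_iota nth0 be0.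
have [j [ltj nj subB]] : exists j, [/\ j < size (diag_edges t), k0 != j
    & {subset B <= [:: k0; j]}].
  have : size (rem k0 B) <= 1 by rewrite size_rem //; case: (size B) szB => [|[|[]]].
  have remP k : k \in B -> k != k0 -> k \in rem k0 B.
    by move=> kB nk; rewrite mem_rem_uniq // inE nk.
  case: (rem k0 B) remP (mem_rem_uniq k0 uB) => [|j [|? ?]] // remP memB _.
    (* Only [k0] is broken: any other index completes the pair, here 1 if [k0] is 0 and 0
       otherwise. *)
    exists (k0 == 0 : nat); split=> [||k kB].
    - by apply: leq_trans sz; rewrite ltnS; case: eqP.
    - by case E0: (k0 == 0); [rewrite (eqP E0) | rewrite E0].
    by rewrite !inE; case: eqP => //= /eqP nk; have := remP k kB nk.
  exists j; have := memB j; rewrite !inE eqxx mem_filter mem_iota /= => /esym/and3P[nj _ ltj].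
  split=> //; first by rewrite eq_sym.
  move=> k kB; rewrite !inE; case: eqP => //= /eqP nk.
  by have := remP k kB nk; rewrite inE.
have nexc : ~~ exceptional_pair t k0 j.
  case: (t) nth0 => //= b; rewrite -/d0 => ->.
  by rewrite !inE ![[::] == _]eq_sym (negPf n1) (negPf n2) andbF.
elim: (tc k0 j lt0 ltj nj nexc x y xin yin) => [{xin yin}u v|//|u v w _ -> _ //].
case=> k [ltk kk0 kj adj].
have /negbNE/eqP : ~~ broken f (nth d0 (diag_edges t) k).
  apply/negP=> bk; have /subB : k \in B by rewrite mem_filter bk mem_iota.
  by rewrite !inE (negPf kk0) (negPf kj).
by case/orP: adj => /eqP -> /=.
Qed.

Lemma dedges_size t p env : 2 <= nvars t -> 2 <= size (dedges t p env).
Proof.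
have szc p0 d c e0 : size (child_edge p0 d c e0) = 1 by case: c.
elim: t p env => [i|u _ v _|b IHb] p env //=.
  by rewrite !size_cat !szc.
by rewrite size_cat => /IHb H; apply: leq_trans (H _ _) (leq_addl _ _).
Qed.

Section Connected.

Variable t : lterm.
Hypotheses (tc : three_connected t) (plt : pl t) (sz : 2 <= nvars t).

Let root_vertex : [::] \in diag_vertices t.
Proof. by case: t sz => //= *; rewrite inE eqxx. Qed.

(** The cut consists of the edge entering [s] and the edges of its free atoms. Depth at least two
    keeps the upper end of the entering edge off the root. *)
Lemma exc_proper s q e :
  occurs t [::] [::] s q e -> nonleaf s -> 1 < size q -> 2 <= exc s.
Proof.
move=> o ns q1; rewrite leqNgt; apply/negP => lt2.
have fq : prefix q q by apply: prefix_refl.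
have qn : q != [::] by case: (q) q1.
have f0 : prefix q [::] = false by rewrite prefixs0 (negPf qn).
have [//|[q0 [d [Eq E]]]] := occurs_edge o ns; first by move=> Eq; rewrite Eq in q1.
have Ebr := br_occurs o plt ns f0 (fun z H => H) isT.
have := br_const e (occurs_pl o plt) (fun z (H : prefix q z) => H).
have -> : kap (prefix q) s q e = true by case: (s) ns.
rewrite eqxx add0n => Es.
have le2 : br (prefix q) t [::] [::] <= 2.
  rewrite Ebr (negPf qn) fq addn1 Es; apply: leq_ltn_trans (count_size _ _) lt2.
have H := @cut_const t (prefix q) (q0, q) [::] q tc (dedges_size _ _ sz) le2 E.
suff : prefix q [::] = prefix q q by rewrite f0 fq.
apply: H => //.
- suff npq : ~~ prefix q q0 by rewrite /broken [prefix q (_, q).2]fq eqb_id.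
  by apply/negP=> /size_prefix; rewrite Eq size_rcons ltnn.
- by rewrite Eq size_rcons in q1; case: (q0) q1.
- exact: occurs_inode o ns.
Qed.

Lemma lam_chain (f : seq nat -> bool) a m p env :
  nonleaf m -> (forall i, i <= a -> f (p ++ nseq i 0)) ->
  exists e, [/\ occurs (iter a Lam m) p env m (p ++ nseq a 0) e,
    br f (iter a Lam m) p env = br f m (p ++ nseq a 0) e,
    forall i, i < a -> f (nth [::] e i) &
    forall i, a <= i -> nth [::] e i = nth [::] env (i - a)].
Proof.
move=> nm; elim: a p env => [|a IHa] p env fp.
  by exists env; rewrite cats0; split=> // [|i _]; [constructor | rewrite subn0].
have [|e [oe bre flt fge]] := IHa (rcons p 0) (p :: env).
  by move=> i lei; rewrite cat_rcons; apply: (fp i.+1).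
exists e; rewrite cat_rcons in oe bre; split=> /=.
- exact: occurs_Lam.
- rewrite br_Lam bre.
  have -> : kap f (iter a Lam m) (rcons p 0) (p :: env) = f (rcons p 0).
    by case: a {IHa fp oe bre flt fge} => //; case: m nm.
  have := fp 0 isT; have := fp 1 isT; rewrite cats0 cats1 => -> ->.
  by rewrite eqxx.
- move=> i; rewrite ltnS leq_eqVlt => /predU1P[->|]; last exact: flt.
  by rewrite fge // subnn; have := fp 0 isT; rewrite cats0.
- by case=> // i lei; rewrite fge 1?ltnW // subSn //.
Qed.

(** If [v] had exactly [a] free atoms, the abstractions would bind them all. Colouring the
    abstractions, the application and [v], but not [u], would then break only the edge entering [q]
    and the edge to [u], the latter away from the root. *)
Lemma arg_not_closed_off a u v q e :
  occurs t [::] [::] (iter a Lam (App u v)) q e -> q != [::] -> nonleaf u ->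
  0 < a -> exc v != a.
Proof.
set s := iter a Lam _ => o qn nu a_gt0; apply/eqP=> ev.
set q' := q ++ nseq a 0.
pose f z := prefix q z && ~~ prefix (rcons q' 0) z.
have szq' : size q' = size q + a by rewrite size_cat size_nseq.
have fshort z : size z <= size q' -> f z = prefix q z.
  move=> lez; rewrite /f [prefix (rcons _ _) _]negbTE ?andbT //.
  by apply/negP=> /size_prefix; rewrite size_rcons leqNgt ltnS lez.
have fch i : i <= a -> f (q ++ nseq i 0).
  by move=> lei; rewrite fshort ?prefix_prefix // szq' size_cat size_nseq leq_add2l.
have [e' [oa bra flt fge]] := @lam_chain f a (App u v) q e isT fch.
rewrite -/q' -/s in oa bra.
have fq : f q by have := fch 0 isT; rewrite cats0.
have fq' : f q' by apply: fch.
have f0 : f [::] = false by rewrite fshort // prefixs0 (negPf qn).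
have ns : nonleaf s by rewrite /s; case: (a).
have pls := occurs_pl o plt.
have Ebr := br_occurs o plt ns f0 (fun z (H : f z) => proj1 (andP H)) isT.
rewrite (negPf qn) fq bra br_App fq' in Ebr.
have [/andP[plu plv] Efv] := fvs_iter_Lam pls.
have [Ev Eu] : fvs v = iota 0 a /\ fvs u = map (addn a) (fvs s).
  move/eqP: Efv; rewrite -/s [fvs (App _ _)]/= eqseq_cat ?size_iota //.
  by case/andP=> /eqP -> /eqP ->.
have pq' : prefix q q' by apply: prefix_prefix.
have fv z : prefix (rcons q' 1) z -> f z = true.
  move=> pz; apply/andP; split.
    by apply: prefix_trans (prefix_trans pq' (prefix_rcons _ _)) pz.
  by apply/negP=> /prefix_sibling/(_ pz).
have := br_const e' plv fv.
rewrite Ev (_ : count _ _ = 0); last first.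
  apply/eqP; rewrite eqn0Ngt -has_count -all_predC; apply/allP => i /=.
  by rewrite mem_iota => /andP[_ /flt ->].
have fu z : prefix (rcons q' 0) z -> f z = false by move=> pz; rewrite /f pz andbF.
have := br_const e' plu fu.
rewrite Eu (_ : count _ _ = 0); last first.
  apply/eqP; rewrite eqn0Ngt -has_count -all_predC; apply/allP => i /=.
  case/mapP=> j _ ->; rewrite negbK fge ?leq_addr // addKn eq_sym eqbF_neg.
  have lt_e := occurs_env o isT.
  case: (ltnP j (size e)) => [ltj|gej]; last by rewrite nth_default ?f0.
  by apply/negP=> /andP[/size_prefix]; rewrite leqNgt (allP lt_e) ?mem_nth.
have Ku : kap f u (rcons q' 0) e' = false.
  by case: (u) nu => //= *; rewrite /f prefix_refl andbF.
rewrite Ku add0n => bu /eqP; rewrite addn_eq0 => /andP[/eqP kv /eqP bv].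
have le2 : br f t [::] [::] <= 2 by rewrite Ebr Ku bu kv bv.
have ou : occurs t [::] [::] u (rcons q' 0) e'.
  by apply: occurs_trans o _; apply: occurs_trans oa _; do 2!constructor.
have [|[q0 [d [/rcons_inj[Eq _] E]]]] := occurs_edge ou nu; first by case: (q').
have H := @cut_const t f (q0, rcons q' 0) [::] q tc (dedges_size _ _ sz) le2 E.
suff : f [::] = f q by rewrite f0 fq.
apply: H => //=; rewrite -?Eq.
- by rewrite /broken /= fq' /f prefix_refl andbF.
- by rewrite -size_eq0 szq' addn_eq0 size_eq0 (negPf qn).
- by case: (q').
- exact: occurs_inode o ns.
Qed.

Hypothesis nt : Defs.normal t.

(** Dropping outer abstractions turns a failure [exc v <= a] into the equality excluded by
    [arg_not_closed_off]. *)
Lemma occurs_iter_Lam a c s q e : c <= a ->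
  occurs t [::] [::] (iter a Lam s) q e ->
  exists q' e', size q' = size q + (a - c) /\ occurs t [::] [::] (iter c Lam s) q' e'.
Proof.
elim: a q e => [|a IHa] q e; first by case: c => // _ o; exists q, e; rewrite addn0.
rewrite leq_eqVlt => /predU1P[->|]; first by exists q, e; rewrite subnn addn0.
rewrite ltnS => le o; have [|q' [e' [szq' o']]] := IHa (rcons q 0) (q :: e) le.
  by apply: occurs_trans o _; do 2!constructor.
by exists q', e'; rewrite szq' size_rcons subSn // addnS.
Qed.

Lemma occurs_good a s q0 e0 :
  occurs t [::] [::] (iter a Lam s) q0 e0 -> 1 < size q0 -> good a s.
Proof.
elim: s a q0 e0 => [i|u IHu v IHv|b IHb] a q0 e0 o szq.
- case: a o => // a o; have := exc_proper o isT szq.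
  by have := exc_iter_Lam (occurs_pl o plt); rewrite /exc /=; lia.
- have [q [e [szq' oa]]] := occurs_iter_Lam (leq0n a) o; rewrite /= in oa.
  have szq1 d : 1 < size (rcons q d) by rewrite size_rcons szq'; lia.
  have ou : occurs t [::] [::] u (rcons q 0) e.
    by apply: occurs_trans oa _; do 2!constructor.
  have ov : occurs t [::] [::] v (rcons q 1) e.
    by apply: occurs_trans oa _; constructor 4; constructor.
  have [nu _ _] := normal_App (occurs_normal oa nt).
  rewrite /= nu (IHu 0 _ _ ou) // (IHv 0 _ _ ov) // !andbT ltnNge; apply/negP => lea.
  have ev0 : 0 < exc v.
    by case E: (nonleaf v); [apply: ltnW (exc_proper ov E (szq1 _)) | case: (v) E].
  (* When [u] is a variable, [exc v <= a] leaves at most one free atom to the whole block, against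
     [exc_proper]. *)
  case E: (nonleaf u); last first.
    have ns : nonleaf (iter a Lam (App u v)) by case: (a).
    have := exc_proper o ns szq; have := exc_iter_Lam (occurs_pl o plt).
    rewrite exc_App; have -> : exc u = 1 by case: (u) E.
    by lia.
  have [q1 [e1 [szq1' o1]]] := occurs_iter_Lam lea o.
  have := arg_not_closed_off o1 _ E ev0; rewrite eqxx => H.
  by suff : false by []; apply: H; rewrite -size_eq0 szq1'; lia.
- by apply: (IHb a.+1 q0 e0) => //; rewrite iterSr.
Qed.

(** The abstractions at the top bind exactly the [exc v + exc u] free atoms of the body. An operator
    that is not a variable has at least two of them, so the innermost [exc v] abstractions do not
    start at the root and close off [v]. *)
Lemma occurs_topgood a s : fvs t = [::] -> t = iter a.+1 Lam s -> topgood s.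
Proof.
move=> ft; elim: s a => [i|u _ v _|b IHb] a Et; last first.
- by apply: (IHb a.+1); rewrite iterSr.
- have o : occurs t [::] [::] (iter a.+1 Lam (App u v)) [::] [::] by rewrite -Et; constructor.
  have [q [e [szq oa]]] := occurs_iter_Lam (leq0n _) o; rewrite /= subn0 add0n in oa szq.
  have szq1 d : 1 < size (rcons q d) by rewrite size_rcons szq.
  have ou : occurs t [::] [::] u (rcons q 0) e.
    by apply: occurs_trans oa _; do 2!constructor.
  have ov : occurs t [::] [::] v (rcons q 1) e.
    by apply: occurs_trans oa _; constructor 4; constructor.
  have ev0 : 0 < exc v.
    by case E: (nonleaf v); [apply: ltnW (exc_proper ov E (szq1 _)) | case: (v) E].
  have ex : exc v + exc u = a.+1.
    rewrite -exc_App; have pls := plt; rewrite Et in pls.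
    by rewrite (exc_iter_Lam pls) -Et /exc ft /= addn0.
  case E: (nonleaf u); last first.
    by case: (u) E => // i _; apply: (@occurs_good 0 v _ _ ov).
  have eu := exc_proper ou E (szq1 _).
  have lea : exc v <= a.+1 by lia.
  have [q1 [e1 [szq1' o1]]] := occurs_iter_Lam lea o.
  have := arg_not_closed_off o1 _ E ev0; rewrite eqxx => H.
  by suff : false by []; apply: H; rewrite -size_eq0 szq1' /=; lia.
- suff Esz : nvars t = 1 by have := sz; rewrite Esz.
  by rewrite Et; elim: {Et} a.
Qed.

End Connected.

(** The head of a neutral normal term is a free variable. *)
Lemma exc_neutral_gt0 t : pl t -> Defs.normal t -> neutral t -> 0 < exc t.
Proof.
elim: t => [//|u IHu v _|//] /andP[plu _] /normal_App[nu nnu _] _.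
by rewrite exc_App ltn_addl // IHu.
Qed.

Lemma topgood_normal t : topgood t -> Defs.normal t.
Proof.
have gn a s : good a s -> Defs.normal s.
  elim: s a => [//|u IHu v IHv|b IHb] a /=; last exact: IHb.
  by case/and4P=> _ nu /IHu nnu /IHv nnv; case: u nu nnu {IHu} => //= *; apply/andP.
by elim: t => [//|[i|//|//] _ v _|b IHb] //=; apply: gn.
Qed.

Theorem good_termP n t : 2 <= n ->
  good_term n t <-> [/\ fvs t = [::], pl t, topgood t & nvars t = n].
Proof.
move=> n2; split=> [[lt nt plant tc szt]|[ft plt gt szt]].
  have /andP[/eqP ft plt] : (fvs t == [::]) && pl t by rewrite -linear_planarP lt plant.
  split=> //; rewrite -szt in n2.
  have Et : neutral t = false.
    by apply/negP=> nut; have := exc_neutral_gt0 plt nt nut; rewrite /exc ft.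
  case: t {lt plant szt} => // b in tc plt nt ft n2 Et *.
  exact: (@occurs_topgood (Lam b) tc plt n2 nt 0 b ft erefl).
have /andP[lt plant] : linear t && planar t by rewrite linear_planarP ft plt.
split=> //; [exact: topgood_normal | exact: topgood_three_connected].
Qed.

(** * Decomposition trees *)

(* Tutte's decomposition of a rooted bipartite map by deletion of the root edge,
   which either is a bridge between two maps ([Br]) or separates the root face, of
   degree [2j], from another face ([Ch _ j]). *)
Inductive btree := Em | Br (t1 t2 : btree) | Ch (t : btree) (j : nat).

(* Half the degree of the root face. *)
Fixpoint bdeg t :=
  match t with Em => 0 | Br t1 t2 => (bdeg t1 + bdeg t2).+1 | Ch _ j => j end.

Fixpoint bsize t :=
  match t with Em => 0 | Br t1 t2 => (bsize t1 + bsize t2).+1 | Ch t _ => (bsize t).+1 end.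

Fixpoint bvalid t :=
  match t with
  | Em => true
  | Br t1 t2 => bvalid t1 && bvalid t2
  | Ch t j => [&& 0 < j, j <= bdeg t & bvalid t]
  end.

(** The left spine of a tree mirrors the applications leading to a head variable. It ends in [Em]
    for a neutral term; an end [Ch] records abstractions together with the last argument, and [plug]
    puts it there. *)
Fixpoint plug t x :=
  match t with Em => x | Br t1 t2 => Br (plug t1 x) t2 | Ch _ _ => t end.

Fixpoint spine_end t :=
  match t with Em => None | Br t1 _ => spine_end t1 | Ch t j => Some (t, j) end.

Fixpoint spine t :=
  match t with Em => Em | Br t1 t2 => Br (spine t1) t2 | Ch _ _ => Em end.

Lemma plug_spine t :
  t = if spine_end t is Some (s, j) then plug (spine t) (Ch s j) else spine t.
Proof. by elim: t => [|t1 IH t2 _|t _ j] //=; case: (spine_end t1) IH => [[s j]|] <-. Qed.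

Lemma bdeg_plug t x : spine_end t = None -> bdeg (plug t x) = bdeg t + bdeg x.
Proof. by elim: t => [|t1 IH t2 _|] //= /IH ->; lia. Qed.

Lemma bsize_plug t x : spine_end t = None -> bsize (plug t x) = bsize t + bsize x.
Proof. by elim: t => [|t1 IH t2 _|] //= /IH ->; lia. Qed.

Lemma bvalid_plug t x : spine_end t = None -> bvalid (plug t x) = bvalid t && bvalid x.
Proof. by elim: t => [|t1 IH t2 _|] //= /IH ->; rewrite andbAC. Qed.

Lemma spine_end_spine t : spine_end (spine t) = None.
Proof. by elim: t. Qed.

(* Codes [t] preceded by [a] abstractions. *)
Fixpoint tree_of (a : nat) (t : lterm) : btree :=
  match t with
  | Var _ => Em
  | Lam b => tree_of a.+1 b
  | App u v =>
      if a == 0 then Br (tree_of 0 u) (tree_of 0 v)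
      else plug (tree_of 0 u) (Ch (tree_of 0 v) ((bdeg (tree_of 0 v)).+1 - a))
  end.

Lemma spine_end_neutral u : good 0 u -> neutral u -> spine_end (tree_of 0 u) = None.
Proof. by elim: u => // u IHu v _ /= /and4P[_ nu gu _] _; apply: IHu. Qed.

(** The number of free atoms minus one adds up along applications like the half degree along
    bridges. For a block the label is [exc v - a], and [a < exc v] is its positivity. *)
Lemma tree_of_prop a s : good a s -> pl s ->
  [/\ exc s = a + (bdeg (tree_of a s)).+1, bvalid (tree_of a s)
    & nvars s = (bsize (tree_of a s)).+1].
Proof.
elim: s a => [i|u IHu v IHv|b IHb] a.
- by move/eqP->.
- case/and4P=> av nu gu gv /andP[plu plv].
  have [eu vu su] := IHu 0 gu plu; have [ev vv sv] := IHv 0 gv plv.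
  have sp := spine_end_neutral gu nu; rewrite exc_App eu ev [nvars _]/= su sv.
  case: a av => [|a] av /=; first by rewrite vu vv; split=> //; lia.
  rewrite bdeg_plug // bsize_plug // bvalid_plug // vu /= vv andbT.
  by rewrite ev in av; split; lia.
- move=> gb plb; have [eb vb sb] := IHb a.+1 gb (proj1 (pl_Lam plb)).
  by split=> //; have := exc_Lam plb; rewrite eb /=; lia.
Qed.

(* Terms up to the names of atoms. *)
Fixpoint shape t :=
  match t with Var _ => Var 0 | App u v => App (shape u) (shape v) | Lam b => Lam (shape b) end.

Definition close (p : lterm * option (lterm * nat)) :=
  if p.2 is Some (s, a) then iter a Lam (App p.1 s) else p.1.

(** Inverse of [tree_of] on shapes. The first component rebuilds the operator along the left spine;
    the second keeps the argument and the number of abstractions found in a final [Ch], which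
    [close] places outermost. *)
Fixpoint shape_of_tree t : lterm * option (lterm * nat) :=
  match t with
  | Em => (Var 0, None)
  | Br t1 t2 =>
      (App (shape_of_tree t1).1 (close (shape_of_tree t2)), (shape_of_tree t1).2)
  | Ch t j => (Var 0, Some (close (shape_of_tree t), (bdeg t).+1 - j))
  end.

Lemma shape_of_tree_None t : spine_end t = None -> (shape_of_tree t).2 = None.
Proof. by elim: t. Qed.

Lemma shape_of_tree_plug t s j : spine_end t = None ->
  shape_of_tree (plug t (Ch s j)) = ((shape_of_tree t).1, (shape_of_tree (Ch s j)).2).
Proof. by elim: t => [|t1 IH t2 _|] //= /IH ->. Qed.

Lemma tree_ofK a s : good a s -> pl s ->
  close (shape_of_tree (tree_of a s)) = iter a Lam (shape s).
Proof.
elim: s a => [i|u IHu v IHv|b IHb] a.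
- by move/eqP->.
- case/and4P=> av nu gu gv /andP[plu plv].
  have sp := spine_end_neutral gu nu; have [ev _ _] := tree_of_prop gv plv.
  have := IHu 0 gu plu; rewrite /close shape_of_tree_None //= => Eu.
  case: a av => [|a] av /=.
    by rewrite /close /= shape_of_tree_None //= Eu; congr App; apply: (IHv 0).
  rewrite shape_of_tree_plug // /close /= Eu.
  have -> : (bdeg (tree_of 0 v)).+1 - ((bdeg (tree_of 0 v)).+1 - a.+1) = a.+1 by lia.
  by congr (iter _ _ (App _ _)); apply: (IHv 0).
- by move=> gb plb; rewrite /= (IHb a.+1) ?iterSr //; case/pl_Lam: plb.
Qed.

Lemma shape_exc s s' : pl s -> pl s' -> shape s = shape s' -> exc s = exc s'.
Proof.
elim: s s' => [i|u IHu v IHv|b IHb] [i'|u' v'|b'] //=.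
  by move=> /andP[? ?] /andP[? ?] [/IHu Eu /IHv Ev]; rewrite !exc_App Eu ?Ev.
move=> plb plb' [/IHb Eb]; apply/succn_inj; rewrite -!exc_Lam //.
by apply: Eb; [case/pl_Lam: plb | case/pl_Lam: plb'].
Qed.

(** Each abstraction binds the first free atom of its body, so the shape and the list of free atoms
    determine every index. *)
Lemma shape_inj s s' : pl s -> pl s' -> fvs s = fvs s' -> shape s = shape s' -> s = s'.
Proof.
elim: s s' => [i|u IHu v IHv|b IHb] [i'|u' v'|b'] //.
- by move=> _ _ [->].
- move=> /andP[plu plv] /andP[plu' plv'] /= /eqP + [Eu Ev].
  rewrite eqseq_cat; last exact: shape_exc.
  by case/andP=> /eqP Fv /eqP Fu; congr App; [apply: IHu | apply: IHv].
- move=> /pl_Lam[plb Eb] /pl_Lam[plb' Eb'] F [Es].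
  by congr Lam; apply: IHb; rewrite // Eb Eb' F.
Qed.

(** The list [l] is arbitrary because subterms are built before their binders. [core] realises the
    spine by a neutral term, [ends] treats the [Ch] closing it, [full] joins them; one induction
    proves all three, since [Br t1 t2] uses only the spine and the end of [t1]. *)
Lemma tree_of_surj t : bvalid t ->
  forall l, size l = (bdeg t).+1 ->
  exists s, [/\ good 0 s, pl s, fvs s = l & tree_of 0 s = t].
Proof.
pose full t := forall l, size l = (bdeg t).+1 ->
  exists s, [/\ good 0 s, pl s, fvs s = l & tree_of 0 s = t].
pose core t := forall l, size l = (bdeg (spine t)).+1 ->
  exists s, [/\ good 0 s && neutral s, pl s, fvs s = l & tree_of 0 s = spine t].
pose ends t := forall s j, spine_end t = Some (s, j) -> 0 < j <= bdeg s /\ full s.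
suff H : forall t0, bvalid t0 -> [/\ core t0, ends t0 & full t0] by case/H.
have fullI t0 : core t0 -> ends t0 -> full t0.
  move=> ct et l szl; have Et := plug_spine t0; have sp := spine_end_spine t0.
  case E: (spine_end t0) Et => [[x j]|] Et; last first.
    rewrite Et in szl; have [s [/andP[gs _] pls fs Es]] := ct l szl.
    by exists s; split=> //; rewrite Es -Et.
  have [/andP[j0 jle] fx] := et _ _ E.
  rewrite Et bdeg_plug //= in szl; pose a := (bdeg x).+1 - j.
  (* Free atoms wanted for [u v]: those to be bound by the [a] abstractions, then [l] shifted below
     them. *)
  pose L := iota 0 a ++ map (addn a) l.
  have szL : size L = (bdeg x).+1 + (bdeg (spine t0)).+1.
    by rewrite size_cat size_iota size_map szl /a; lia.
  have [|v [gv plv fv Ev]] := fx (take (bdeg x).+1 L).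
    by rewrite size_takel // szL leq_addr.
  have [|u [/andP[gu nu] plu fu Eu]] := ct (drop (bdeg x).+1 L).
    by rewrite size_drop szL addKn.
  have [plt ft] : pl (iter a Lam (App u v)) /\ fvs (iter a Lam (App u v)) = l.
    by apply: iter_LamI; rewrite /= ?plu // fv fu cat_take_drop.
  exists (iter a Lam (App u v)); split=> //.
    have : good a (App u v).
      rewrite /= nu gu gv /exc fv size_takel ?szL ?leq_addr // /a; lia.
    have shift k c s : good k (iter c Lam s) = good (k + c) s.
      by elim: c k => [|c IHc] k /=; rewrite ?addn0 // IHc addSnnS.
    by rewrite shift.
  have shift k c s : tree_of k (iter c Lam s) = tree_of (k + c) s.
    by elim: c k => [|c IHc] k /=; rewrite ?addn0 // IHc addSnnS.
  rewrite shift /= Eu Ev [RHS]Et.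
  have -> : a == 0 = false by rewrite /a; lia.
  by congr (plug _ (Ch _ _)); rewrite /a; lia.
have coreEm : core Em.
  by case=> [|i [|? ?]] // _; exists (Var i).
elim=> [_|t1 IH1 t2 IH2|t0 IH j].
- have eE : ends Em by [].
  by split=> //; apply: fullI.
- case/andP=> /IH1[c1 e1 _] /IH2[_ _ f2].
  have cB : core (Br t1 t2).
    move=> l szl; rewrite /= in szl.
    have [|v [gv plv fv Ev]] := f2 (take (bdeg t2).+1 l); first by rewrite size_takel // szl; lia.
    have [|u [/andP[gu nu] plu fu Eu]] := c1 (drop (bdeg t2).+1 l); first by rewrite size_drop szl; lia.
    exists (App u v); split=> /=.
    + by rewrite nu gu gv /exc fv size_takel // szl; lia.
    + by rewrite plu.
    + by rewrite fv fu cat_take_drop.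
    + by rewrite Eu Ev.
  by split=> //; apply: fullI.
- case/and3P=> j0 jle /IH[_ _ f].
  have eC : ends (Ch t0 j) by move=> s j' [<- <-]; rewrite j0 jle.
  by split=> //; apply: fullI.
Qed.

(** * Closed terms and valid trees *)

Fixpoint term_tree t :=
  match t with Lam b => term_tree b | App _ v => tree_of 0 v | Var _ => Em end.

Lemma topgood_iter_Lam t : topgood t ->
  exists a i v, t = iter a Lam (App (Var i) v) /\ good 0 v.
Proof.
elim: t => [//|[i|//|//] _ v _|b IHb] /=; first by exists 0, i, v.
by case/IHb=> a [i [v [-> gv]]]; exists a.+1, i, v.
Qed.

(** The free atoms below the abstractions are all of [iota 0 a]; the head variable comes last in the
    walk, so it has the largest index and its binder is the root. *)
Lemma closed_topgood t : fvs t = [::] -> pl t -> topgood t ->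
  exists v, [/\ t = iter (exc v).+1 Lam (App (Var (exc v)) v), good 0 v,
    pl v & fvs v = iota 0 (exc v)].
Proof.
move=> ft plt /topgood_iter_Lam[a [i [v [Et gv]]]].
rewrite {}Et in ft plt *; have [plA] := fvs_iter_Lam plt.
rewrite ft cats0 /= cats1 => Ev.
have Ea : a = (exc v).+1 by have := congr1 size Ev; rewrite size_rcons size_iota.
move: Ev; rewrite Ea -[(exc v).+1]addn1 iotaD cats1 add0n => /rcons_inj[Ev ->].
by exists v; rewrite addn1.
Qed.

Lemma term_tree_iter a i v : term_tree (iter a Lam (App (Var i) v)) = tree_of 0 v.
Proof. by elim: a. Qed.

Lemma term_treeP n t : 2 <= n -> good_term n t ->
  bvalid (term_tree t) /\ bsize (term_tree t) = n - 2.
Proof.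
move=> n2 /(good_termP _ n2)[ft plt gt szt].
have [v [Et gv plv _]] := closed_topgood ft plt gt.
have [ev vv sv] := tree_of_prop gv plv; rewrite Et term_tree_iter; split=> //.
move: szt; rewrite Et; have -> : forall a s, nvars (iter a Lam s) = nvars s.
  by elim.
by rewrite /= sv; lia.
Qed.

Lemma term_tree_inj n t t' : 2 <= n -> good_term n t -> good_term n t' ->
  term_tree t = term_tree t' -> t = t'.
Proof.
move=> n2 /(good_termP _ n2)[ft plt gt szt] /(good_termP _ n2)[ft' plt' gt' szt'].
have [v [-> gv plv fv]] := closed_topgood ft plt gt.
have [v' [-> gv' plv' fv']] := closed_topgood ft' plt' gt'.
rewrite !term_tree_iter => E.
have [ev _ _] := tree_of_prop gv plv; have [ev' _ _] := tree_of_prop gv' plv'.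
have Ee : exc v = exc v' by rewrite ev ev' E.
rewrite -Ee in fv' *.
suff -> : v = v' by [].
apply: shape_inj => //; first by rewrite fv fv'.
by have := tree_ofK gv plv; rewrite E tree_ofK.
Qed.

Lemma term_tree_surj n x : 2 <= n -> bvalid x -> bsize x = n - 2 ->
  exists2 t, good_term n t & term_tree t = x.
Proof.
move=> n2 vx szx.
have [|v [gv plv fv Ev]] := tree_of_surj vx (l := iota 0 (bdeg x).+1).
  by rewrite size_iota.
have ev : exc v = (bdeg x).+1 by rewrite /exc fv size_iota.
have plA : pl (App (Var (exc v)) v) by rewrite /= plv.
have fA : fvs (App (Var (exc v)) v) = iota 0 (exc v).+1 ++ map (addn (exc v).+1) [::].
  by rewrite /= fv cats0 -[RHS]/(iota 0 (exc v).+1) -[(exc v).+1]addn1 iotaD ev.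
have [plt ft] := iter_LamI plA fA.
exists (iter (exc v).+1 Lam (App (Var (exc v)) v)); last first.
  by rewrite term_tree_iter.
apply/(good_termP _ n2); split=> //.
  by elim: (exc v).+1.
have -> : forall a s, nvars (iter a Lam s) = nvars s by elim.
have [_ _ sv] := tree_of_prop gv plv.
by rewrite /= sv Ev szx; lia.
Qed.

(** * Rooted planar hypermaps *)

Section Orbits.

Variable T : finType.
Implicit Types (s t : {perm T}) (x y z r : T).

Lemma porbits_tperm_l s x y :
  #|porbits (tperm x y * s)| + (x \notin porbit s y).*2 = #|porbits s| + (x != y).
Proof. exact: porbits_mul_tperm. Qed.

Lemma porbits_tperm_r s x y :
  #|porbits (s * tperm x y)| + (x \notin porbit s y).*2 = #|porbits s| + (x != y).
Proof.
rewrite -porbitsV invMg tpermV -(porbitsV s).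
by rewrite -(porbits_mul_tperm s^-1 x y) porbitV.
Qed.

Lemma porbit_fix s x y : s x = x -> (x \in porbit s y) = (x == y).
Proof.
move=> sx; rewrite porbit_sym; apply/porbitP/eqP => [[i ->]|->]; last by exists 0; rewrite perm1.
by rewrite permX; elim: i => //= i <-; rewrite sx.
Qed.

Lemma porbit_inv s (f : T -> bool) x y :
  (forall z, f (s z) = f z) -> y \in porbit s x -> f y = f x.
Proof.
by move=> fs /porbitP[i ->]; rewrite permX; elim: i => //= i <-; rewrite fs.
Qed.

Lemma porbit_eq_on s t x :
  (forall z, z \in porbit s x -> t z = s z) -> porbit t x = porbit s x.
Proof.
move=> ts; have E i : (t ^+ i)%g x = (s ^+ i)%g x.
  elim: i => [|i IH]; first by rewrite !perm1.
  by rewrite !expgSr !permM IH ts // mem_porbit.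
by apply/setP=> z; apply/porbitP/porbitP => -[i ->]; exists i; rewrite E.
Qed.

Lemma porbit_fconnect s x y : (y \in porbit s x) = fconnect s x y.
Proof.
apply/porbitP/idP => [[i ->]|xy]; first by rewrite permX fconnect_iter.
by exists (findex s x y); rewrite permX iter_findex.
Qed.

Lemma porbit_cycle s x p : fcycle s (x :: p) -> porbit s x =i x :: p.
Proof. by move=> cyc y; rewrite porbit_fconnect (fconnect_cycle cyc) ?mem_head. Qed.

Lemma card_porbit_cycle s x p :
  fcycle s (x :: p) -> uniq (x :: p) -> #|porbit s x| = (size p).+1.
Proof.
move=> cyc un; rewrite (eq_card (porbit_cycle cyc)).
exact: (card_uniqP un).
Qed.

Lemma cycle_of_porbit s x : exists p, fcycle s (x :: p) /\ uniq (x :: p).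
Proof.
have := card_porbit_neq0 s x; have := uniq_traject_porbit s x.
have := iter_porbit s x; case: #|_| => // m E un _.
exists (traject s (s x) m); split=> //.
rewrite /= (_ : rcons _ x = traject s (s x) m.+1); first exact: fpath_traject.
by rewrite trajectSr -iterSr E.
Qed.

Lemma path_sources (s t : T -> T) y p :
  (forall z, z \in belast y p -> t z = s z) -> fpath s y p -> fpath t y p.
Proof.
elim: p y => // z p IH y ts /= /andP[/eqP sz pth].
rewrite ts ?mem_head // sz eqxx IH // => w wp; apply: ts.
by rewrite /= inE wp orbT.
Qed.

(** Products apply the left factor first, so [tperm r x * s] puts the fixed point [r] right after
    [x]. *)
Lemma cycle_insert s r x p : s r = r -> r != x ->
  fcycle s (x :: p) -> uniq (x :: p) ->
  fcycle (tperm r x * s)%g (r :: rcons p x) /\ uniq (r :: rcons p x).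
Proof.
move=> sr rx cyc un; have nr : r \notin x :: p.
  by rewrite -(porbit_cycle cyc) porbit_fix.
split; last by rewrite /= mem_rcons nr rcons_uniq.
move: cyc un nr; rewrite /= inE negb_or => cyc /andP[xp _] /andP[_ rp].
rewrite rcons_path last_rcons /= permM tpermR sr eqxx andbT.
case: p cyc xp rp => [|y p] /=; first by rewrite permM tpermL.
rewrite permM tpermL; case/andP=> -> pth xp rp /=.
apply: path_sources pth => z; rewrite belast_rcons => zp.
by rewrite permM tpermD //; apply: contraTneq zp => <-.
Qed.

Lemma path_targets s r y x p :
  r \notin p -> y \notin p -> fpath s x p -> fpath (s * tperm r y)%g x p.
Proof.
elim: p x => //= z p IH x; rewrite !inE !negb_or => /andP[rz rp] /andP[yz yp].
by case/andP=> /eqP sx pth; rewrite permM sx tpermD // eqxx IH.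
Qed.

(** Right multiplication exchanges the arrows entering [r] and [y], so the arrow into [y] now closes
    the cycle after [p1]. *)
Lemma cycle_split s r y p1 p2 :
  fcycle s (r :: p1 ++ y :: p2) -> uniq (r :: p1 ++ y :: p2) ->
  fcycle (s * tperm r y)%g (r :: p1).
Proof.
rewrite /= rcons_cat cat_path rcons_cons.
move=> /andP[pth /= /andP[/eqP lst _]] /andP[rp up].
rewrite rcons_path /= permM lst tpermR eqxx andbT.
move: rp up; rewrite mem_cat negb_or cat_uniq => /andP[rp _] /and3P[_ /= yp _].
by apply: path_targets pth => //; case/norP: yp.
Qed.

Lemma cycle_merge s r y p q :
  fcycle s (r :: p) -> uniq (r :: p) -> fcycle s (y :: q) -> uniq (y :: q) ->
  r \notin y :: q ->
  fcycle (s * tperm r y)%g (r :: p ++ y :: q) /\ uniq (r :: p ++ y :: q).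
Proof.
move=> cp up cq uq ry.
have rny : r \notin porbit s y by rewrite (porbit_cycle cq).
have disj z : z \in r :: p -> z \notin y :: q.
  rewrite -(porbit_cycle cp) -eq_porbit_mem => /eqP zr; apply: contra rny.
  by rewrite -(porbit_cycle cq) -!eq_porbit_mem zr.
split; last first.
  rewrite -cat_cons cat_uniq up uq andbT.
  by apply/hasPn=> z zy; apply: contraL zy => /disj.
move: cp up cq uq ry => /= + /andP[rp _] + /andP[yq _].
rewrite !rcons_path => /andP[pp /eqP lp] /andP[pq /eqP lq] ry.
rewrite cat_path last_cat /= !permM lp lq tpermL tpermR !eqxx /= andbT.
have yp : y \notin p.
  by apply/negP=> yp; have := disj y; rewrite !inE yp eqxx orbT => /(_ isT).
move: ry; rewrite inE negb_or => /andP[_ rq].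
by rewrite !path_targets.
Qed.

End Orbits.

(** * Inserting a fixed point: lengths and number of cycles *)

Section Insertion.

Variable T : finType.
Implicit Types (s : {perm T}) (x y z r : T).

Lemma porbit_insert_other s r x y z : s r = r -> z != r ->
  z \notin porbit s x -> z \notin porbit s y ->
  porbit (tperm r x * s * tperm r y)%g z = porbit s z.
Proof.
move=> sr zr zx zy; apply: porbit_eq_on => w wz.
have nr u : u \in porbit s z -> r != u.
  by apply: contraTneq => <-; rewrite porbit_fix // eq_sym.
have swz : s w \in porbit s z.
  by move: wz; rewrite -!eq_porbit_mem => /eqP <-; rewrite eq_porbit_mem (mem_porbit s 1).
have xw : x != w by apply: contraNneq zx => ->; rewrite porbit_sym.
have yw : y != s w by apply: contraNneq zy => ->; rewrite porbit_sym.
by rewrite !permM (tpermD (nr _ wz) xw) tpermD ?nr.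
Qed.

Lemma insert_cycle s r x : s r = r -> exists p,
  [/\ fcycle (tperm r x * s)%g (r :: p), uniq (r :: p) &
    size p = if x == r then 0 else #|porbit s x|].
Proof.
move=> sr; case: eqVneq => [->|xr].
  by exists [::]; rewrite tperm1 mul1g /= sr eqxx.
have [p [cyc un]] := cycle_of_porbit s x; exists (rcons p x).
rewrite eq_sym in xr; have [cyc' un'] := cycle_insert sr xr cyc un.
by split=> //; rewrite size_rcons -(card_porbit_cycle cyc un).
Qed.

(** The half degree of the root face when the root edge is a bridge; [x = r] or [y = r] stands for
    an empty map at that end. *)
Lemma card_porbit_insert_merge s r x y : s r = r ->
  (y != r -> y \notin porbit s x) ->
  #|porbit (tperm r x * s * tperm r y)%g r| =
  ((if x == r then 0 else #|porbit s x|) + if y == r then 0 else #|porbit s y|).+1.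
Proof.
move=> sr nxy; have [p [cp up szp]] := insert_cycle x sr.
case: eqVneq nxy => [->|yr] nxy.
  by rewrite tperm1 mulg1 (card_porbit_cycle cp up) szp addn0.
have [q [cq uq]] := cycle_of_porbit (tperm r x * s)%g y.
have Ey : porbit (tperm r x * s)%g y = porbit s y.
  have := @porbit_insert_other s r x r y sr yr (nxy isT).
  by rewrite tperm1 mulg1; apply; rewrite porbit_sym porbit_fix // eq_sym.
have ry : r \notin y :: q by rewrite -(porbit_cycle cq) Ey porbit_fix // eq_sym.
have [c u] := cycle_merge cp up cq uq ry.
rewrite (card_porbit_cycle c u) size_cat -Ey (card_porbit_cycle cq uq) /= szp.
by [].
Qed.

(** The new cycle is [r] followed by the first [j - 1] iterates of [x]: inserting [r] after [x]
    gives all of them, and the second transposition cuts in front of the [j]-th. *)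
Lemma card_porbit_insert_split s r x j : s r = r -> x != r ->
  0 < j <= #|porbit s x| ->
  #|porbit (tperm r x * s * tperm r (iter j s x))%g r| = j.
Proof.
move=> sr xr; have [p [cyc un]] := cycle_of_porbit s x.
rewrite (card_porbit_cycle cyc un); case: j => // j; rewrite ltnS => jle.
rewrite eq_sym in xr; have [cyc' un'] := cycle_insert sr xr cyc un.
have Ep : rcons p x = traject s (s x) (size p).+1.
  by have := fcycle_rconsE cyc; rewrite [RHS]trajectS => -[].
have Es : rcons p x = traject s (s x) j ++
    iter j.+1 s x :: traject s (iter j.+2 s x) (size p - j).
  have Esz : (size p).+1 = j + (size p - j).+1 by rewrite addnS subnKC.
  by rewrite Ep Esz trajectD trajectS -iterSr -iterS.
rewrite Es in cyc' un'.
have c := cycle_split cyc' un'.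
rewrite (card_porbit_cycle c) ?size_traject //.
by move: un'; rewrite -cat_cons cat_uniq => /and3P[].
Qed.

Lemma card_porbits_insert s r x y : s r = r ->
  #|porbits (tperm r x * s * tperm r y)%g| + (x != r) + (y != r)
  = #|porbits s| + ([&& x != r, y != r & y \in porbit s x]).*2.
Proof.
move=> sr; have [p [cp up szp]] := insert_cycle x sr.
have := porbits_tperm_l s r x; rewrite porbit_fix // [r == x]eq_sym.
have := porbits_tperm_r (tperm r x * s)%g r y; rewrite [r == y]eq_sym.
have -> : r \in porbit (tperm r x * s)%g y = (y == r) || (x != r) && (y \in porbit s x).
  rewrite porbit_sym; case: (eqVneq y r) => [->|yr] /=; first exact: porbit_id.
  case: (eqVneq x r) => [->|xr] /=.
    by rewrite tperm1 mul1g porbit_sym porbit_fix // eq_sym (negPf yr).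
  have [q [cyc un]] := cycle_of_porbit s x; rewrite eq_sym in xr.
  have [cyc' un'] := cycle_insert sr xr cyc un.
  rewrite (porbit_cycle cyc') inE (negPf yr) mem_rcons.
  by rewrite (porbit_cycle cyc).
by case: (y == r); case: (x == r); case: (y \in porbit s x) => /=; lia.
Qed.

End Insertion.

(** * Components and Euler's inequality *)

Section Components.

Variable T : finType.
Implicit Types (a b : {perm T}) (x y z r : T) (f g : {ffun T -> bool}).

Definition invf a b (f : T -> bool) := forall z, f (a z) = f z /\ f (b z) = f z.

Definition invs a b : {set {ffun T -> bool}} :=
  [set f : {ffun T -> bool} | [forall z, (f (a z) == f z) && (f (b z) == f z)]].

(* [#|invs a b|] is two to the number of components. *)
Definition comps a b := logn 2 #|invs a b|.

Lemma invsP a b f : reflect (invf a b f) (f \in invs a b).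
Proof.
rewrite inE; apply: (iffP forallP) => H z; last by have [-> ->] := H z; rewrite !eqxx.
by have /andP[/eqP ? /eqP ?] := H z.
Qed.

Lemma invf_insert a b r x y (f : T -> bool) : a r = r -> b r = r ->
  invf (tperm r x * a)%g (b * tperm r y)%g f <->
  [/\ invf a b f, f r = f x & f r = f y].
Proof.
move=> ar brr; split=> [H|[H fx fy] z].
  have fx : f r = f x by have [] := H x; rewrite permM tpermR ar.
  have fy : f r = f y by have [_] := H r; rewrite permM brr tpermL.
  split=> // z; split.
    by have [+ _] := H (tperm r x z); rewrite permM tpermK => ->; case: tpermP => [->|->|].
  by have [_] := H z; rewrite permM => <-; case: tpermP => [->|->|].
rewrite !permM; split; first by rewrite (proj1 (H _)); case: tpermP => [->|->|].
by rewrite -(proj2 (H z)); case: tpermP => [->|->|].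
Qed.

Lemma invs_gt0 a b : 0 < #|invs a b|.
Proof.
apply/card_gt0P; exists [ffun => true]; apply/invsP => z; by rewrite !ffunE.
Qed.

(** Adding [g] modulo 2 is an involution of [S] that exchanges the functions agreeing at [x] and [y]
    with the others. *)
Lemma card_half (S : {set {ffun T -> bool}}) g x y :
  (forall f f', f \in S -> f' \in S -> [ffun z => f z (+) f' z] \in S) ->
  g \in S -> g x != g y ->
  #|S| = 2 * #|[set f in S | f x == f y]|.
Proof.
move=> closed gS gxy; pose A := [set f : {ffun T -> bool} | f x == f y].
have -> : [set f in S | f x == f y] = S :&: A by apply/setP=> f; rewrite !inE.
rewrite -(cardsID A S) mul2n -addnn; congr (_ + _).
pose h f : {ffun T -> bool} := [ffun z => f z (+) g z].
have hK : involutive h by move=> f; apply/ffunP=> z; rewrite !ffunE -addbA addbb addbF.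
rewrite -(card_imset _ (inv_inj hK)); apply: eq_card => f.
rewrite -{1}(hK f) (mem_imset _ _ (inv_inj hK)) !inE !ffunE.
have -> : (h f \in S) = (f \in S).
  by apply/idP/idP=> fS; [rewrite -(hK f)|]; apply: closed.
rewrite andbC; congr (_ && _).
by case: (f x) (f y) (g x) (g y) gxy => [] [] [] [].
Qed.

Lemma invs_xor a b f f' :
  f \in invs a b -> f' \in invs a b -> [ffun z => f z (+) f' z] \in invs a b.
Proof.
move=> /invsP H /invsP H'; apply/invsP => z.
by rewrite !ffunE; have [-> ->] := H z; have [-> ->] := H' z.
Qed.

Lemma invs_insert a b r x y : a r = r -> b r = r ->
  invs (tperm r x * a)%g (b * tperm r y)%g =
  [set f in [set f in invs a b | f r == f x] | f r == f y].
Proof.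
move=> ar br; apply/setP=> f; rewrite [in RHS]inE [in RHS]inE.
apply/invsP/andP; first by case/(invf_insert _ _ _ ar br) => /invsP -> -> ->; rewrite !eqxx.
by case=> /andP[/invsP H /eqP fx] /eqP fy; apply/invf_insert.
Qed.

Section Insert.
Variables (a b : {perm T}) (r x y : T).
Hypotheses (ar : a r = r) (br : b r = r).

Let S1 := [set f in invs a b | f r == f x].

Let isolated : exists2 g, g \in invs a b & forall z, g z = (z == r).
Proof.
exists [ffun z => z == r]; last by move=> z; rewrite ffunE.
apply/invsP=> z; rewrite !ffunE -{1}ar (inj_eq perm_inj); split=> //.
by rewrite -{1}br (inj_eq perm_inj).
Qed.

Let card_S1 : #|invs a b| = 2 ^ (x != r) * #|S1|.
Proof.
have [g gS gE] := isolated; case: (eqVneq x r) => [xr|xr]; last first.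
  rewrite (@card_half _ g r x) ?expn1 //; first exact: invs_xor.
  by rewrite !gE eqxx (negPf xr).
by rewrite mul1n; apply: eq_card => f; rewrite !inE xr eqxx andbT.
Qed.

Let S1_xor f f' : f \in S1 -> f' \in S1 -> [ffun z => f z (+) f' z] \in S1.
Proof.
rewrite ![_ \in S1]inE => /andP[fS /eqP fx] /andP[fS' /eqP fx'].
by rewrite invs_xor // !ffunE fx fx' eqxx.
Qed.

Let ins_gt0 := invs_gt0 (tperm r x * a)%g (b * tperm r y)%g.

Lemma comps_insert_merge :
  (x != r -> y != r -> exists2 f, f \in invs a b & f x != f y) ->
  comps a b = comps (tperm r x * a)%g (b * tperm r y)%g + (x != r) + (y != r).
Proof.
move=> sep; suff E : #|S1| = 2 ^ (y != r) * #|invs (tperm r x * a)%g (b * tperm r y)%g|.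
  rewrite /comps card_S1 E !lognM ?muln_gt0 ?expn_gt0 // !lognX logn_prime //=.
  by rewrite !muln1 addnC -addnA addnC -addnA [_ + (y != r)]addnC.
rewrite invs_insert //; case: (eqVneq y r) => [yr|yr]; last first.
  have [g gS1 gy] : exists2 g, g \in S1 & g r != g y.
    have [g gS gE] := isolated; case: (eqVneq x r) => [xr|xr].
      by exists g; [rewrite inE gS xr eqxx | rewrite !gE eqxx (negPf yr)].
    have [f fS fxy] := sep xr yr.
    (* [f] with its value at the isolated [r] changed to [f x]: it satisfies the first equation and
       violates the second, which is thus independent. *)
    exists [ffun z => if g z then f x else f z]; last by rewrite !ffunE !gE eqxx (negPf yr).
    rewrite inE; apply/andP; split; last by rewrite !ffunE !gE eqxx (negPf xr).
    apply/invsP=> z; rewrite !ffunE; have [-> ->] := invsP _ _ _ gS z.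
    by have [-> ->] := invsP _ _ _ fS z.
  by rewrite (@card_half _ g r y).
by rewrite mul1n; apply: eq_card => f; rewrite [RHS]inE yr eqxx andbT.
Qed.

Lemma comps_insert_split : x != r -> y != r ->
  (forall f, f \in invs a b -> f x = f y) ->
  comps a b = (comps (tperm r x * a)%g (b * tperm r y)%g).+1.
Proof.
move=> xr yr nsep; rewrite /comps card_S1 invs_insert //.
have -> : [set f in S1 | f r == f y] = S1.
  apply/setP=> f; rewrite inE; case fS: (f \in S1) => //=.
  by move: fS; rewrite inE => /andP[/nsep <- ->].
have S1_gt0 : 0 < #|S1| by have := invs_gt0 a b; rewrite card_S1 muln_gt0 => /andP[].
by rewrite xr lognM // logn_prime // add1n.
Qed.

End Insert.

(** Vertices plus faces: the cycles of [a] and [b] are the black and white vertices, those of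
    [a * b] the faces. *)
Definition cycles a b := #|porbits a| + #|porbits b| + #|porbits (a * b)%g|.

(** Inserting on the left of [a] and on the right of [b] makes the transpositions the outer factors
    of [a * b], so the same two transpositions act on the faces. *)
Lemma cycles_insert a b r x y : a r = r -> b r = r ->
  cycles (tperm r x * a)%g (b * tperm r y)%g + (x != r).*2 + (y != r).*2
  = cycles a b + ([&& x != r, y != r & y \in porbit (a * b)%g x]).*2.
Proof.
move=> ar br; have abr : (a * b)%g r = r by rewrite permM ar br.
have := card_porbits_insert x y abr.
have := porbits_tperm_l a r x; rewrite porbit_fix //.
have := porbits_tperm_r b r y; rewrite porbit_fix //.
rewrite /cycles !mulgA [r == x]eq_sym [r == y]eq_sym.
by move: (#|_|) (#|_|) (#|_|) (#|_|) (#|_|) (#|_|); case: (_ == _); case: (_ == _);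
   case: (_ \in _) => *; lia.
Qed.

(** [x] precedes [r] around its black vertex and [y] follows it around its white vertex; equality
    with [r] means an end of degree one. *)
Lemma deletion a b r : exists a' b' x y,
  [/\ a = (tperm r x * a')%g, b = (b' * tperm r y)%g, a' r = r & b' r = r].
Proof.
exists (tperm r (a^-1 r) * a)%g, (b * tperm r (b r))%g, (a^-1 r)%g, (b r).
split; first by rewrite mulgA tperm2 mul1g.
- by rewrite -mulgA tperm2 mulg1.
- by rewrite permM tpermL permKV.
- by rewrite permM tpermR.
Qed.

Lemma sep_dec a b x y : (exists2 f, f \in invs a b & f x != f y) \/
  (forall f, f \in invs a b -> f x = f y).
Proof.
case: (boolP [exists f in invs a b, f x != f y]) => [/exists_inP|]; first by left.
by move/exists_inPn=> H; right=> f /H; rewrite negbK => /eqP.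
Qed.

Lemma mem_porbit_inv a b f x y :
  f \in invs a b -> y \in porbit (a * b)%g x -> f x = f y.
Proof.
move=> /invsP H yx; apply: esym; apply: porbit_inv yx => z.
by rewrite permM (proj2 (H _)) (proj1 (H _)).
Qed.

Lemma euler_id : cycles 1 1 = #|T| + (comps 1 1).*2.
Proof.
have card1 : #|porbits (1%g : {perm T})| = #|T|.
  rewrite /porbits card_imset // => x y /eqP; rewrite eq_porbit_mem.
  by rewrite porbit_fix ?perm1 // => /eqP.
rewrite /cycles mulg1 card1 /comps.
have -> : invs 1%g 1%g = [set: {ffun T -> bool}].
  by apply/setP=> f; rewrite [RHS]inE; apply/invsP => z; rewrite perm1.
by rewrite cardsT card_ffun card_bool lognX logn_prime // muln1; lia.
Qed.

(** Induction on the number of darts moved by [a] or [b]. Deleting [r] keeps the difference of the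
    two sides, unless [x] and [y] stay in one component on different faces: then [r] is a handle,
    and its deletion lowers the difference by two. *)
Theorem euler_le a b : cycles a b <= #|T| + (comps a b).*2.
Proof.
have [m] := ubnP #|[set z | (a z != z) || (b z != z)]|.
elim: m a b => // m IH a b; rewrite ltnS => le_m.
case: (set_0Vmem [set z | (a z != z) || (b z != z)]) => [E0|[r rab]].
  have a1 : a = 1%g.
    apply/permP=> z; have := in_set0 z; rewrite -E0 inE perm1.
    by case: eqP.
  have b1 : b = 1%g.
    apply/permP=> z; have := in_set0 z; rewrite -E0 inE perm1.
    by case: (b z =P z); rewrite ?orbT.
  by rewrite a1 b1 euler_id.
have [a' [b' [x [y [Ea Eb ar br]]]]] := deletion a b r.
have lt_m : #|[set z | (a' z != z) || (b' z != z)]| < m.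
  apply: leq_trans le_m; apply: proper_card; apply/properP; split; last first.
    by exists r => //; rewrite inE ar br eqxx.
  apply/subsetP=> z; rewrite !inE Ea Eb !permM => /orP[az|bz].
    have zr : z != r by apply: contraNneq az => ->; rewrite ar.
    case: tpermP => [Ez|_|_ _]; [by rewrite Ez eqxx in zr | by rewrite ar eq_sym zr |].
    by rewrite az.
  have zr : z != r by apply: contraNneq bz => ->; rewrite br.
  case: (tpermP r y (b' z)) => [Ez|_|_ _]; [|by rewrite [r == z]eq_sym zr orbT|by rewrite bz orbT].
  by rewrite -br in Ez; rewrite (perm_inj Ez) eqxx in zr.
have := IH a' b' lt_m; have := cycles_insert x y ar br; rewrite -Ea -Eb.
have nosep := mem_porbit_inv.
case: (boolP [&& x != r, y != r & y \in porbit (a' * b')%g x]) => [/and3P[xr yr yx]|nC].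
  have := @comps_insert_split a' b' r x y ar br xr yr (fun f fS => nosep _ _ f _ _ fS yx).
  by rewrite -Ea -Eb xr yr; lia.
case: (sep_dec a' b' x y) => [sep|nsep].
  have := @comps_insert_merge a' b' r x y ar br (fun _ _ => sep).
  by rewrite -Ea -Eb; lia.
case: (boolP ((x != r) && (y != r))) => [/andP[xr yr]|].
  have := @comps_insert_split a' b' r x y ar br xr yr nsep.
  by rewrite -Ea -Eb xr yr; lia.
rewrite negb_and !negbK => xyr.
have : comps a' b' = comps a b + (x != r) + (y != r).
  rewrite Ea Eb; apply: comps_insert_merge => // xr yr.
  by rewrite (negPf xr) (negPf yr) in xyr.
by lia.
Qed.

End Components.

(** * Forests of rooted planar hypermaps *)

Section States.

Variable E : finType.
Implicit Types (A : {set E}) (a b : {perm E}) (rs : seq (option E)) (ts : seq btree).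

(* [rep A a b rs ts]: the hypermap [(a, b)] with set of darts [A] has one component
   for each [Some r] in [rs], and these rooted components, with [None] standing for
   the empty map, decompose as [ts]. Darts out of [A] are fixed by [a] and [b]. *)
Inductive rep : {set E} -> {perm E} -> {perm E} -> seq (option E) -> seq btree -> Prop :=
| rep_nil : rep set0 1%g 1%g [::] [::]
| rep_Em A a b rs ts : rep A a b rs ts -> rep A a b (None :: rs) (Em :: ts)
| rep_Br A a b ox oy rs t1 t2 ts r :
    rep A a b (ox :: oy :: rs) (t1 :: t2 :: ts) -> r \notin A ->
    rep (r |: A) (tperm r (odflt r ox) * a)%g (b * tperm r (odflt r oy))%g
        (Some r :: rs) (Br t1 t2 :: ts)
| rep_Ch A a b x rs t ts r j :
    rep A a b (Some x :: rs) (t :: ts) -> r \notin A -> 0 < j <= bdeg t ->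
    rep (r |: A) (tperm r x * a)%g (b * tperm r (iter j (a * b)%g x))%g
        (Some r :: rs) (Ch t j :: ts).

Definition root_darts rs : seq E := pmap id rs.

(** [state_cover] puts a root in each component within [A], [state_sep] puts the roots in distinct
    components. A dart out of [A] is a component with three cycles and satisfies Euler's equality,
    so planarity can be stated on the whole type. *)
Record state A a b rs : Prop := State {
  state_fix : forall z, z \notin A -> a z = z /\ b z = z;
  state_roots : forall r, r \in root_darts rs -> r \in A;
  state_cover : forall f, f \in invs a b ->
    (forall r, r \in root_darts rs -> f r = false) -> forall z, z \in A -> f z = false;
  state_sep : forall bs, size bs = size (root_darts rs) ->
    exists2 f, f \in invs a b & map f (root_darts rs) = bs;
  state_euler : cycles a b = #|E| + (comps a b).*2 }.

Definition rdeg (s : {perm E}) (o : option E) := if o is Some r then #|porbit s r| else 0.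

Lemma mem_roots rs r : (r \in root_darts rs) = (Some r \in rs).
Proof. by rewrite mem_pmap map_id. Qed.

Lemma roots_cat rs rs' : root_darts (rs ++ rs') = root_darts rs ++ root_darts rs'.
Proof. exact: pmap_cat. Qed.

Lemma state_sep_cat A a b rs0 rs c bs : state A a b (rs0 ++ rs) ->
  size bs = size (root_darts rs) -> exists f, [/\ f \in invs a b,
    forall z, z \in root_darts rs0 -> f z = c & map f (root_darts rs) = bs].
Proof.
move=> st szb; have [|f fS] := state_sep st (bs := nseq (size (root_darts rs0)) c ++ bs).
  by rewrite size_cat size_nseq szb roots_cat size_cat.
rewrite roots_cat map_cat => /eqP; rewrite eqseq_cat ?size_map ?size_nseq //.
case/andP=> /eqP E0 /eqP E1; exists f; split=> // z z0.
by have := map_f f z0; rewrite E0 mem_nseq => /andP[_ /eqP].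
Qed.

Lemma state_root_sep A a b rs0 rs z x : state A a b (rs0 ++ rs) ->
  z \in root_darts rs -> x \in root_darts rs0 -> z \notin porbit (a * b)%g x.
Proof.
move=> st zr xr; have [f [fS f0 f1]] := @state_sep_cat _ _ _ _ _ true
  (nseq (size (root_darts rs)) false) st (size_nseq _ _).
apply/negP=> /(mem_porbit_inv fS); rewrite (f0 _ xr).
by have := map_f f zr; rewrite f1 mem_nseq => /andP[_ /eqP ->].
Qed.

Lemma invs_update a b r f (c : bool) : a r = r -> b r = r -> f \in invs a b ->
  [ffun z => if z == r then c else f z] \in invs a b.
Proof.
move=> ar br /invsP fS; apply/invsP=> z; rewrite !ffunE.
have -> : (a z == r) = (z == r) by rewrite -{1}ar (inj_eq perm_inj).
have -> : (b z == r) = (z == r) by rewrite -{1}br (inj_eq perm_inj).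
by have [-> ->] := fS z.
Qed.

Section StateInsert.
Variables (A : {set E}) (a b : {perm E}) (rs0 rs : seq (option E)) (r x y : E).
Hypotheses (st : state A a b (rs0 ++ rs)) (rA : r \notin A)
  (hx : x != r -> x \in root_darts rs0)
  (hy : y != r -> y \in root_darts rs0 \/ x != r /\ y \in porbit (a * b)%g x)
  (h0 : forall z, z \in root_darts rs0 -> z = x \/ z = y).

Let ar : a r = r. Proof. by case: (state_fix st rA). Qed.
Let br : b r = r. Proof. by case: (state_fix st rA). Qed.

Let rs0A z : z \in root_darts rs0 -> z \in A.
Proof. by move=> z0; apply: (state_roots st); rewrite roots_cat mem_cat z0. Qed.

Let rsA z : z \in root_darts rs -> z \in A.
Proof. by move=> z1; apply: (state_roots st); rewrite roots_cat mem_cat z1 orbT. Qed.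

Let xA : x \in r |: A.
Proof. by rewrite in_setU1; case: eqP => //= /eqP /hx/rs0A. Qed.

Let yA : y \in r |: A.
Proof.
rewrite in_setU1; case: eqP => //= /eqP /hy[/rs0A //|[/hx/rs0A xA' yx]].
apply: contraLR xA' => yA'; have [ay by'] := state_fix st yA'.
by move: yx; rewrite porbit_fix ?permM ?ay // => /eqP <-.
Qed.

Lemma insert_other z : z \in root_darts rs ->
  porbit (tperm r x * a * (b * tperm r y))%g z = porbit (a * b)%g z.
Proof.
move=> zr; rewrite mulgA -(mulgA _ a).
have zn : z != r by apply: contraNneq rA => <-; apply: rsA.
have abr : (a * b)%g r = r by rewrite permM ar br.
have zx : z \notin porbit (a * b)%g x.
  case: (eqVneq x r) => [->|/hx xr]; last exact: state_root_sep st zr xr.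
  by rewrite porbit_sym porbit_fix // eq_sym.
apply: porbit_insert_other => //.
case: (eqVneq y r) => [->|/hy[yr|[_ yx]]].
- by rewrite porbit_sym porbit_fix // eq_sym.
- exact: state_root_sep st zr yr.
- by move: yx; rewrite -eq_porbit_mem => /eqP ->.
Qed.

(** [rs0] lists the roots absorbed by [r]. The two alternatives in [hy] are the bridge and the chord
    of a face. *)
Lemma state_insert :
  cycles (tperm r x * a)%g (b * tperm r y)%g =
    #|E| + (comps (tperm r x * a)%g (b * tperm r y)%g).*2 ->
  state (r |: A) (tperm r x * a)%g (b * tperm r y)%g (Some r :: rs).
Proof.
move=> eul; have invP f : f \in invs (tperm r x * a)%g (b * tperm r y)%g ->
    [/\ f \in invs a b, f r = f x & f r = f y].
  by case/invsP/(invf_insert _ _ _ ar br)=> /invsP.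
split=> //.
- move=> z zA; have zx : x != z by apply: contraNneq zA => <-.
  have zy : y != z by apply: contraNneq zA => <-.
  move: zA; rewrite in_setU1 negb_or eq_sym => /andP[zr zA].
  by have [az bz] := state_fix st zA; rewrite !permM bz !tpermD.
- move=> z; rewrite [root_darts _]/= inE in_setU1 => /predU1P[->|/rsA ->]; by rewrite ?eqxx ?orbT.
- move=> f /invP[fS fx fy] fz; have fr : f r = false by apply: fz; rewrite inE eqxx.
  move=> z /setU1P[->//|zA]; apply: (state_cover st) fS _ z zA => z.
  rewrite roots_cat mem_cat => /orP[/h0[->|->]|zr]; rewrite -?fx -?fy //.
  by apply: fz; rewrite inE zr orbT.
- case=> // c bs [szb]; have [f [fS f0 f1]] := state_sep_cat c st szb.
  exists [ffun z => if z == r then c else f z].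
    have gS := invs_update c ar br fS; apply/invsP/invf_insert=> //; split=> //.
    + exact/invsP.
    + by rewrite !ffunE eqxx; case: eqVneq => // /hx/f0.
    + rewrite !ffunE eqxx; case: eqVneq => // /hy[/f0//|[/hx/f0 <-]].
      by apply: mem_porbit_inv.
  rewrite [root_darts _]/= [map _ _]/= ffunE eqxx -[in RHS]f1; congr (_ :: _).
  apply/eq_in_map => z /rsA zA; rewrite ffunE; case: eqP => // zr.
  by have := rA; rewrite -zr zA.
Qed.

End StateInsert.

Lemma state_nil : state set0 1%g 1%g [::].
Proof.
split=> //.
- by move=> z _; rewrite !perm1.
- by move=> f _ _ z; rewrite inE.
- case=> // _; exists [ffun=> false] => //; apply/invsP => z; by rewrite !ffunE.
- exact: euler_id.
Qed.

Lemma euler_insert_merge a b r x y : a r = r -> b r = r ->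
  (x != r -> y != r -> exists2 f, f \in invs a b & f x != f y) ->
  cycles a b = #|E| + (comps a b).*2 <->
  cycles (tperm r x * a)%g (b * tperm r y)%g =
    #|E| + (comps (tperm r x * a)%g (b * tperm r y)%g).*2.
Proof.
move=> ar br sep; have := comps_insert_merge ar br sep; have := cycles_insert x y ar br.
have -> : [&& x != r, y != r & y \in porbit (a * b)%g x] = false.
  apply/negP=> /and3P[xr yr yx]; have [f fS] := sep xr yr.
  by rewrite (mem_porbit_inv fS yx) eqxx.
by split; lia.
Qed.

Lemma euler_insert_split a b r x y : a r = r -> b r = r ->
  x != r -> y != r -> y \in porbit (a * b)%g x ->
  cycles a b = #|E| + (comps a b).*2 <->
  cycles (tperm r x * a)%g (b * tperm r y)%g =
    #|E| + (comps (tperm r x * a)%g (b * tperm r y)%g).*2.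
Proof.
move=> ar br xr yr yx; have := cycles_insert x y ar br; rewrite xr yr yx.
have := comps_insert_split ar br xr yr (fun f fS => mem_porbit_inv fS yx).
by split; lia.
Qed.

Lemma rep_state A a b rs ts : rep A a b rs ts ->
  [/\ state A a b rs, map (rdeg (a * b)%g) rs = map bdeg ts,
      all bvalid ts & #|A| = sumn (map bsize ts)].
Proof.
elim=> {A a b rs ts} [|A a b rs ts _ [st dg va ca]
  |A a b ox oy rs t1 t2 ts r _ [st dg va ca] rA|A a b x rs t ts r j _ [st dg va ca] rA jt].
- by split=> //; [exact: state_nil | rewrite cards0].
- split=> //=; last by rewrite dg.
  by case: st => *; split.
- rewrite -[ox :: _]/([:: ox; oy] ++ rs) in st.
  set x := odflt r ox; set y := odflt r oy.
  have [ar br] := state_fix st rA.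
  have hx : x != r -> x \in root_darts [:: ox; oy].
    by rewrite /x; case: (ox) => [z|]; rewrite /= ?inE ?eqxx.
  have hy : y != r -> y \in root_darts [:: ox; oy].
    by rewrite /y; case: (ox) => [w|]; case: (oy) => [z|]; rewrite /= ?inE ?eqxx ?orbT.
  have h0 z : z \in root_darts [:: ox; oy] -> z = x \/ z = y.
    rewrite /x /y; case: (ox) => [w|]; case: (oy) => [w'|] //=; rewrite !inE;
      by [case/orP=> /eqP; auto | move/eqP; auto].
  have sep : x != r -> y != r -> exists2 f, f \in invs a b & f x != f y.
    rewrite /x /y; case: (ox) st => [z|] st' /=; last by rewrite eqxx.
    case: (oy) st' => [w|] st' /=; last by rewrite eqxx.
    have [|f fS] := state_sep st' (bs := true :: false :: nseq (size (root_darts rs)) false).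
      by rewrite /= size_nseq.
    by case=> fz fw _ _ _; exists f => //; rewrite fz fw.
  have st' := state_insert st rA hx (fun yr => or_introl (hy yr)) h0
    (proj1 (euler_insert_merge ar br sep) (state_euler st)).
  move: dg va ca => /= [d1 d2 drs] /and3P[-> -> ->] ca; split=> //=.
    have abr : (a * b)%g r = r by rewrite permM ar br.
    congr (_ :: _); last first.
      rewrite -drs; apply/eq_in_map => -[z|] // zr /=.
      rewrite (insert_other st rA hx (fun yr => or_introl (hy yr))) //.
      by rewrite mem_roots.
    rewrite mulgA -(mulgA _ a) card_porbit_insert_merge //; last first.
      move=> yr; case: (eqVneq x r) => [->|xr].
        by rewrite porbit_sym porbit_fix // eq_sym.
      by have [f fS] := sep xr yr; apply: contraNN => /(mem_porbit_inv fS) ->; rewrite eqxx.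
    have rd o : (forall z, o = Some z -> z \in A) ->
        (if odflt r o == r then 0 else #|porbit (a * b)%g (odflt r o)|) = rdeg (a * b)%g o.
      case: o => [z|] /=; last by rewrite eqxx.
      by move=> /(_ z erefl) zA; case: eqP => // zr; rewrite -zr zA in rA.
    have stA z : z \in [:: ox; oy] -> forall w, z = Some w -> w \in A.
      move=> zin w Ew; apply: (state_roots st); rewrite roots_cat mem_cat.
      by rewrite mem_roots -Ew zin.
    rewrite !rd ?d1 ?d2 //; first by apply: stA; rewrite !inE eqxx orbT.
    by apply: stA; rewrite !inE eqxx.
  by rewrite cardsU1 rA ca; lia.
- rewrite -[_ :: rs]/([:: Some x] ++ rs) in st.
  have [ar br] := state_fix st rA; have abr : (a * b)%g r = r by rewrite permM ar br.
  have xA : x \in A by apply: (state_roots st); rewrite /= inE eqxx.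
  have xr : x != r by apply: contraNneq rA => <-.
  set y := iter j _ x; have yx : y \in porbit (a * b)%g x by rewrite /y -permX mem_porbit.
  have yr : y != r.
    by apply: contraNneq xr => yr; move: yx; rewrite yr porbit_fix // eq_sym.
  have hx : x != r -> x \in root_darts [:: Some x] by rewrite /= inE eqxx.
  have h0 z : z \in root_darts [:: Some x] -> z = x \/ z = y.
    by rewrite /= inE => /eqP; left.
  have st' := state_insert st rA hx (fun=> or_intror (conj xr yx)) h0
    (proj1 (euler_insert_split ar br xr yr yx) (state_euler st)).
  move: dg va ca => /= [d1 drs] /andP[vt vts] ca; split=> //=.
  + congr (_ :: _); last first.
      rewrite -drs; apply/eq_in_map => -[z|] // zr /=.
      rewrite (insert_other st rA hx (fun=> or_intror (conj xr yx))) //.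
      by rewrite mem_roots.
    by rewrite mulgA -(mulgA _ a) card_porbit_insert_split // d1.
  + by case/andP: jt => -> ->; rewrite vt vts.
  + by rewrite cardsU1 rA ca; lia.
Qed.

End States.

(** * Deleting and adding root edges *)

Section Decomposition.

Variable E : finType.
Implicit Types (A : {set E}) (a b : {perm E}) (rs : seq (option E)) (ts : seq btree).

Definition root_of r (x : E) := if x == r then None else Some x.

Lemma odflt_root_of r x : odflt r (root_of r x) = x.
Proof. by rewrite /root_of; case: eqP => [->|]. Qed.

Section StateDelete.
Variables (A : {set E}) (a b : {perm E}) (rs : seq (option E)) (r x y : E).
Hypotheses (ar : a r = r) (br : b r = r).
Hypothesis st : state A (tperm r x * a)%g (b * tperm r y)%g (Some r :: rs).

Let rA : r \in A. Proof. by apply: (state_roots st); rewrite inE eqxx. Qed.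

Let r_notin : r \notin root_darts rs.
Proof.
have [|f _ [fr E0]] := state_sep st (bs := true :: nseq (size (root_darts rs)) false).
  by rewrite /= size_nseq.
apply/negP=> rin; have := map_f f rin; rewrite E0 fr mem_nseq.
by case/andP.
Qed.

Let xA : x != r -> x \in A.
Proof.
apply: contraNT => /(state_fix st)[]; rewrite permM tpermR ar => -> _.
by rewrite eqxx.
Qed.

Let yA : y != r -> y \in A.
Proof.
apply: contraNT => /(state_fix st)[_] H; apply/eqP.
have : (b * tperm r y)%g y = (b * tperm r y)%g r by rewrite H permM br tpermL.
by move/perm_inj.
Qed.

Lemma state_delete rs0 :
  (forall z, z \in root_darts rs0 -> z != r /\ (z = x \/ z = y)) ->
  (x != r -> x \in root_darts rs0) ->
  (y != r -> y \in root_darts rs0 \/ y \in porbit (a * b)%g x) ->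
  (forall bs, size bs = size (root_darts (rs0 ++ rs)) ->
     exists2 f, f \in invs a b & map f (root_darts (rs0 ++ rs)) = bs) ->
  cycles a b = #|E| + (comps a b).*2 ->
  state (A :\ r) a b (rs0 ++ rs).
Proof.
move=> h0 hx hy sep eul; split=> //.
- move=> z; rewrite in_setD1 negb_and negbK => /predU1P[->//|zA].
  have zr : z != r by apply: contraNneq zA => ->.
  have [az bz] := state_fix st zA.
  have xz : x != z.
    apply: contraNneq zA => xz; apply: contraT => zA; rewrite -xz in az zr.
    by move: az; rewrite permM tpermR ar => rx; rewrite rx eqxx in zr.
  split; first by move: az; rewrite permM tpermD // eq_sym.
  move: bz; rewrite permM; case: tpermP => [bz zE|bz zE|//].
    by rewrite -br in bz; rewrite (perm_inj bz) eqxx in zr.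
  by rewrite zE eqxx in zr.
- move=> z; rewrite roots_cat mem_cat in_setD1 => /orP[/h0[zr E0]|zr].
    by case: E0 zr => -> zr; rewrite zr; [apply: xA | apply: yA].
  have -> : z != r by apply: contraNneq r_notin => <-.
  by apply: (state_roots st); rewrite inE zr orbT.
- move=> f fS fz z /setD1P[zr zA].
  pose f' := [ffun z => if z == r then false else f z].
  have fx : f' x = false.
    rewrite ffunE; case: eqVneq => // /hx xin; apply: fz.
    by rewrite roots_cat mem_cat xin.
  have f'S : f' \in invs a b by apply: invs_update.
  have fy : f' y = false.
    rewrite ffunE; case: eqVneq => // yr; case: (hy yr) => [yin|yx].
      by apply: fz; rewrite roots_cat mem_cat yin.
    by have := mem_porbit_inv f'S yx; rewrite fx ffunE (negPf yr).
  have -> : f z = f' z by rewrite ffunE (negPf zr).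
  apply: (state_cover st) => //; last first.
    move=> w; rewrite inE ffunE => /predU1P[->|wr]; first by rewrite eqxx.
    by case: eqP => // _; apply: fz; rewrite roots_cat mem_cat wr orbT.
  apply/invsP/invf_insert=> //; split; [exact/invsP | |]; by rewrite [f' r]ffunE eqxx.
Qed.

End StateDelete.

(** The root edge is a chord if [x] and [y] are on one face after its deletion. Otherwise planarity
    makes it a bridge. *)
Lemma state_rep A a b rs : state A a b rs -> exists ts, rep A a b rs ts.
Proof.
(* Deleting a bridge removes one dart but adds one root, hence the weight two on darts; dropping an
   empty map only shortens [rs]. *)
have [m] := ubnP (#|A|.*2 + size rs).
elim: m A a b rs => // m IH A a b [|[r|] rs] lt_m st.
- have A0 : A = set0.
    apply/setP=> z; rewrite inE; apply/negP=> zA.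
    have := state_cover st (f := [ffun => true]) _ _ zA; rewrite ffunE => H.
    by suff : true = false by []; apply: H => //; apply/invsP => w; rewrite !ffunE.
  have [a1 b1] : a = 1%g /\ b = 1%g.
    by split; apply/permP=> z; rewrite perm1; have [] := state_fix st (z := z) _ => //;
      rewrite A0 inE.
  by exists [::]; rewrite A0 a1 b1; constructor.
- have [a' [b' [x [y [Ea Eb ar br]]]]] := deletion a b r.
  rewrite Ea Eb in st *.
  have rA : r \in A by apply: (state_roots st); rewrite inE eqxx.
  have ltA : #|A| = #|A :\ r|.+1 by rewrite (cardsD1 r) rA.
  have Ai : r |: (A :\ r) = A by rewrite setD1K.
  have rAr : r \notin A :\ r by rewrite !inE eqxx.
  have invP f : f \in invs (tperm r x * a')%g (b' * tperm r y)%g ->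
      [/\ f \in invs a' b', f r = f x & f r = f y].
    by case/invsP/(invf_insert _ _ _ ar br)=> /invsP.
  case: (boolP [&& x != r, y != r & y \in porbit (a' * b')%g x]) => [/and3P[xr yr yx]|nC].
    have st' : state (A :\ r) a' b' ([:: Some x] ++ rs).
      apply: (state_delete ar br st).
      + by move=> z; rewrite /= inE => /eqP ->; split=> //; left.
      + by rewrite /= inE eqxx.
      + by right.
      + move=> bs /(state_sep st)[f /invP[fS fx _]] E1; exists f => //.
        by rewrite -E1 /= fx.
      + exact/(euler_insert_split ar br xr yr yx)/(state_euler st).
    have [|ts rp] := IH _ _ _ _ _ st'; first by move: lt_m; rewrite ltA /=; lia.
    have [_ + _ _] := rep_state rp.
    case: ts rp => // t ts rp /= [d1 _].
    (* [j] must be positive: for [y = x] it is the full length of the cycle rather than 0. *)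
    have [j [jt Ey]] : exists j, 0 < j <= bdeg t /\ y = iter j (a' * b')%g x.
      move: yx; rewrite porbit_traject => /trajectP[i]; case: i => [|i] lti Ey; last first.
        by exists i.+1; rewrite -d1; split=> //; apply: ltnW.
      by exists #|porbit (a' * b')%g x|; rewrite iter_porbit -d1 leqnn andbT.
    by exists (Ch t j :: ts); rewrite -Ai Ey; apply: rep_Ch.
  (* If [x] and [y] were connected but on different faces, the hypermap without [r] would violate
     [euler_le]. *)
  have sep : x != r -> y != r -> exists2 f, f \in invs a' b' & f x != f y.
    move=> xr yr; case: (sep_dec a' b' x y) => // nsep.
    have := comps_insert_split ar br xr yr nsep; have := cycles_insert x y ar br.
    have := state_euler st; have := euler_le a' b'.
    by rewrite (negPf nC) xr yr; lia.
  have st' : state (A :\ r) a' b' ([:: root_of r x; root_of r y] ++ rs).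
    apply: (state_delete ar br st).
    + move=> z; rewrite mem_roots !inE /root_of => /orP[].
        by case: (eqVneq x r) => // xr /eqP[->]; split=> //; left.
      by case: (eqVneq y r) => // yr /eqP[->]; split=> //; right.
    + by move=> xr; rewrite mem_roots /root_of (negPf xr) !inE eqxx.
    + by move=> yr; left; rewrite mem_roots /root_of (negPf yr) !inE eqxx orbT.
    + move=> bs; rewrite /root_of; case: eqVneq => [xr|xr]; case: eqVneq => [yr|yr] /=.
      * move=> szb; have [|f /invP[fS _ _] [_ E1]] := state_sep st (bs := true :: bs).
          by rewrite /= szb.
        by exists f.
      * move=> /(state_sep st)[f /invP[fS _ fy] E1]; exists f => //.
        by rewrite -E1 /= fy.
      * move=> /(state_sep st)[f /invP[fS fx _] E1]; exists f => //.
        by rewrite -E1 /= fx.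
      * case: bs => [|cx [|cy bs]] // [szb].
        have [g gS gxy] := sep xr yr.
        have [|h /invP[hS hx hy] [hr h0]] :=
          state_sep st (bs := true :: nseq (size (root_darts rs)) false).
          by rewrite /= size_nseq.
        have [|f /invP[fS fx fy] [fr f0]] := state_sep st (bs := cx :: bs).
          by rewrite /= szb.
        (* [h] marks the component of [r]. There [g], which separates [x] from [y], is adjusted to
           take the values [cx] and [cy]; elsewhere [f] is kept. *)
        exists [ffun z => if h z then g z (+) (g x (+) cx) (+) ((g y (+) g x (+) cx (+) cy) && (g z != g x)) else f z].
          apply/invsP=> z; rewrite !ffunE; have [-> ->] := invsP _ _ _ hS z.
          by have [-> ->] := invsP _ _ _ gS z; have [-> ->] := invsP _ _ _ fS z.
        rewrite !ffunE -hx -hy hr; congr [:: _, _ & _].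
        - by rewrite eqxx andbF; case: (g x) (cx) => [] [].
        - by case: (g x) (g y) gxy (cx) (cy) => [] [] // _ [] [].
        rewrite -f0; apply/eq_in_map => z zr; rewrite ffunE.
        by have := map_f h zr; rewrite h0 mem_nseq => /andP[_ /eqP ->].
    + exact/(euler_insert_merge ar br sep)/(state_euler st).
  have [|ts rp] := IH _ _ _ _ _ st'; first by move: lt_m; rewrite ltA /=; lia.
  have [_ + _ _] := rep_state rp.
  case: ts rp => [|t1 [|t2 ts]] // rp _.
  exists (Br t1 t2 :: ts); rewrite -Ai -{1}(odflt_root_of r x) -{1}(odflt_root_of r y).
  exact: rep_Br.
- have [||ts rp] := IH A a b rs; first by move: lt_m => /=; lia.
    by case: st => *; split.
  by exists (Em :: ts); constructor.
Qed.

(** Both subtrees draw darts from the same type, so they are built in turn on top of the components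
    already there; the bound on sizes provides a fresh dart. *)
Lemma rep_exists t : bvalid t -> forall A a b rs ts, rep A a b rs ts ->
  bsize t + #|A| <= #|E| -> exists A' a' b' o,
  rep A' a' b' (o :: rs) (t :: ts) /\ #|A'| = bsize t + #|A|.
Proof.
have fresh A : #|A| < #|E| -> exists r, r \notin A.
  move=> ltA; have [A0|[r]] := set_0Vmem (~: A); last by rewrite inE; exists r.
  by have := cardsC A; rewrite A0 cards0; lia.
elim: t => [_|t1 IH1 t2 IH2|t IH j] /=.
- by move=> A a b rs ts rp _; exists A, a, b, None; split=> //; constructor.
- case/andP=> v1 v2 A a b rs ts rp szA.
  have [|A2 [a2 [b2 [oy [rp2 c2]]]]] := IH2 v2 _ _ _ _ _ rp.
    by apply: leq_trans szA; rewrite leq_add2r leqW ?leq_addl.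
  have [|A1 [a1 [b1 [ox [rp1 c1]]]]] := IH1 v1 _ _ _ _ _ rp2.
    by rewrite c2 addnA ltnW.
  have [|r rA] := fresh A1; first by rewrite c1 c2 addnA.
  do 4!eexists; split; first exact: rep_Br rp1 rA.
  by rewrite cardsU1 rA add1n c1 c2 addnA.
- case/and3P=> j0 jt v A a b rs ts rp szA.
  have [|A1 [a1 [b1 [o [rp1 c1]]]]] := IH v _ _ _ _ _ rp; first exact: ltnW.
  have [|r rA] := fresh A1; first by rewrite c1.
  have [_ /= [d1 _] _ _] := rep_state rp1.
  case: o rp1 d1 => [x|] rp1 d1; last by rewrite /= in d1; lia.
  do 4!eexists; split; first by apply: (rep_Ch rp1 rA (j := j)); rewrite j0.
  by rewrite cardsU1 rA c1.
Qed.

End Decomposition.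

(** * Trees classify rooted planar hypermaps up to isomorphism *)

Section Uniqueness.

Variable E : finType.
Implicit Types (A : {set E}) (a b psi : {perm E}) (rs : seq (option E)) (ts : seq btree).

Lemma rep_inv A a b rs ts : rep A a b rs ts ->
  match ts with
  | [::] => rs = [::] /\ A = set0 /\ a = 1%g /\ b = 1%g
  | Em :: ts' => exists rs', rs = None :: rs' /\ rep A a b rs' ts'
  | Br t1 t2 :: ts' => exists A' a' b' ox oy rs' r,
      [/\ rs = Some r :: rs', r \notin A', A = r |: A',
        a = (tperm r (odflt r ox) * a')%g /\ b = (b' * tperm r (odflt r oy))%g &
        rep A' a' b' (ox :: oy :: rs') (t1 :: t2 :: ts')]
  | Ch t j :: ts' => exists A' a' b' x rs' r,
      [/\ rs = Some r :: rs', r \notin A', A = r |: A',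
        a = (tperm r x * a')%g /\ b = (b' * tperm r (iter j (a' * b')%g x))%g &
        rep A' a' b' (Some x :: rs') (t :: ts')]
  end.
Proof.
case=> {A a b rs ts} [|A a b rs ts rp|A a b ox oy rs t1 t2 ts r rp rA|A a b x rs t ts r j rp rA jt].
- by [].
- by exists rs.
- by exists A, a, b, ox, oy, rs, r.
- by exists A, a, b, x, rs, r.
Qed.

Definition hiso psi A a b rs A' a' b' rs' :=
  [/\ forall z, (psi z \in A') = (z \in A), forall z, psi (a z) = a' (psi z),
    forall z, psi (b z) = b' (psi z) & map (omap psi) rs = rs'].

(** The permutations are trivial out of [A] and [A'], so composing [psi] with a transposition there
    does no harm. *)
Lemma hiso_fresh psi A a b rs A' a' b' rs' r r' :
  state A a b rs -> state A' a' b' rs' -> hiso psi A a b rs A' a' b' rs' ->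
  r \notin A -> r' \notin A' ->
  exists2 psi', hiso psi' A a b rs A' a' b' rs' & psi' r = r'.
Proof.
move=> st st' [hA ha hb hr] rA rA'; set p := (psi * tperm (psi r) r')%g.
have pin z : z \in A -> p z = psi z.
  move=> zA; rewrite permM tpermD //; first by apply: contraNneq rA => /perm_inj ->.
  by apply: contraNneq rA' => ->; rewrite hA.
have pA z : (p z \in A') = (z \in A).
  rewrite permM -hA; case: tpermP => [->|->|//]; last by rewrite hA (negPf rA) (negPf rA').
  by rewrite hA (negPf rA) (negPf rA').
have comm (s s' : {perm E}) : (forall z, z \notin A -> s z = z) -> (forall z, z \notin A' -> s' z = z) ->
    (forall z, psi (s z) = s' (psi z)) -> forall z, p (s z) = s' (p z).
  move=> fs fs' hs z; case: (boolP (z \in A)) => [zA|zA]; last first.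
    by rewrite fs // fs' // pA.
  rewrite !pin //; apply: contraT => szA.
  by have /perm_inj E1 := fs _ szA; rewrite E1 zA in szA.
exists p; last by rewrite permM tpermL.
split=> //.
- by apply: comm => // z; [case/(state_fix st) | case/(state_fix st')].
- by apply: comm => // z; [case/(state_fix st) | case/(state_fix st')].
- rewrite -hr; apply/eq_in_map => -[z|//] zr /=; rewrite pin //.
  by apply: (state_roots st); rewrite mem_roots.
Qed.

Lemma hiso_insert psi A a b rs0 rs A' a' b' rs0' rs' r x y :
  hiso psi A a b (rs0 ++ rs) A' a' b' (rs0' ++ rs') -> size rs0 = size rs0' ->
  hiso psi (r |: A) (tperm r x * a)%g (b * tperm r y)%g (Some r :: rs)
   (psi r |: A') (tperm (psi r) (psi x) * a')%g (b' * tperm (psi r) (psi y))%g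
   (Some (psi r) :: rs').
Proof.
move=> [hA ha hb hr] sz0; split=> [z|z|z|].
- by rewrite !in_setU1 hA (inj_eq perm_inj).
- by rewrite !permM ha (inj_tperm _ _ _ perm_inj).
- by rewrite !permM (inj_tperm _ _ _ perm_inj) hb.
- move: hr; rewrite map_cat => /eqP; rewrite eqseq_cat ?size_map // => /andP[_ /eqP <-].
  by [].
Qed.

Lemma rep_iso A a b rs ts : rep A a b rs ts ->
  forall A' a' b' rs', rep A' a' b' rs' ts ->
  exists psi, hiso psi A a b rs A' a' b' rs'.
Proof.
elim=> {A a b rs ts} [|A a b rs ts rp IH|A a b ox oy rs t1 t2 ts r rp IH rA
    |A a b x rs t ts r j rp IH rA jt] A' a' b' rs' /rep_inv.
- case=> -> [-> [-> ->]]; exists 1%g; split=> // z; by rewrite !perm1 ?inE.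
- case=> rs1 [-> /IH[psi [hA ha hb hr]]]; exists psi; split=> //.
  by rewrite /= hr.
- case=> A1 [a1 [b1 [ox1 [oy1 [rs1 [r1 [-> rA1 -> [-> ->] rp1]]]]]]].
  have [psi0 h0] := IH _ _ _ _ rp1.
  have [st _ _ _] := rep_state rp; have [st1 _ _ _] := rep_state rp1.
  have [psi h <-] := hiso_fresh st st1 h0 rA rA1; exists psi.
  have [_ _ _ [Ex Ey _]] := h.
  have od o : odflt (psi r) (omap psi o) = psi (odflt r o) by case: o.
  rewrite -Ex -Ey !od.
  exact: (@hiso_insert _ _ _ _ [:: ox; oy] rs _ _ _ [:: ox1; oy1]).
- case=> A1 [a1 [b1 [x1 [rs1 [r1 [-> rA1 -> [-> ->] rp1]]]]]].
  have [psi0 h0] := IH _ _ _ _ rp1.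
  have [st _ _ _] := rep_state rp; have [st1 _ _ _] := rep_state rp1.
  have [psi h <-] := hiso_fresh st st1 h0 rA rA1; exists psi.
  have [_ ha hb [Ex _]] := h.
  have it : psi (iter j (a * b)%g x) = iter j (a1 * b1)%g (psi x).
    by elim: (j) => //= i <-; rewrite !permM hb ha.
  rewrite -Ex -it.
  exact: (@hiso_insert _ _ _ _ [:: Some x] rs _ _ _ [:: Some x1]).
Qed.

(** Turns isomorphic hypermaps into equal ones, to which [rep_det] applies. *)
Lemma rep_conj psi A a b rs ts : rep A a b rs ts ->
  rep (psi @: A) (a ^ psi)%g (b ^ psi)%g (map (omap psi) rs) ts.
Proof.
have inp (B : {set E}) r : r \notin B -> psi r \notin psi @: B.
  by rewrite (mem_imset _ _ perm_inj).
elim=> {A a b rs ts} [|A a b rs ts rp IH|A a b ox oy rs t1 t2 ts r rp IH rA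
    |A a b x rs t ts r j rp IH rA jt].
- by rewrite imset0 !conj1g; constructor.
- exact: rep_Em.
- rewrite imsetU1 !conjMg !tpermJ.
  have od o : psi (odflt r o) = odflt (psi r) (omap psi o) by case: o.
  by rewrite !od; apply: rep_Br IH _; apply: inp.
- rewrite imsetU1 !conjMg !tpermJ.
  have -> : psi (iter j (a * b)%g x) = iter j (a ^ psi * b ^ psi)%g (psi x).
    by rewrite -conjMg; elim: (j) => //= i <-; rewrite permJ.
  by apply: rep_Ch IH _ jt; apply: inp.
Qed.

Lemma insertion_inj A A' a a' b b' r x y x' y' :
  r \notin A -> r \notin A' -> a r = r -> a' r = r -> b r = r -> b' r = r ->
  r |: A = r |: A' -> (tperm r x * a)%g = (tperm r x' * a')%g ->
  (b * tperm r y)%g = (b' * tperm r y')%g ->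
  [/\ A = A', a = a', b = b', x = x' & y = y'].
Proof.
move=> rA rA' ar ar' br br' EA Ea Eb.
have Ex : x = x'.
  apply: (@perm_inj _ (tperm r x * a)%g).
  by rewrite [in RHS]Ea !permM !tpermR ar ar'.
have Ey : y = y'.
  have : (b * tperm r y)%g r = (b' * tperm r y')%g r by rewrite Eb.
  by rewrite !permM br br' !tpermL.
subst x' y'; split=> //; first by rewrite -(setU1K rA) EA setU1K.
  exact: mulgI Ea.
exact: mulIg Eb.
Qed.

(** The deletion of the root dart is unique by [insertion_inj]. A bridge is not a chord, its ends
    lying in different components rather than on one face, and the label [j] of a chord is the
    length of the root cycle. *)
Lemma rep_det A a b rs ts : rep A a b rs ts ->
  forall ts', rep A a b rs ts' -> ts = ts'.
Proof.
have notr A0 a0 b0 rs0 ts0 A1 a1 b1 rs1 ts1 r o o' :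
    rep A0 a0 b0 rs0 ts0 -> rep A1 a1 b1 rs1 ts1 -> r \notin A0 -> r \notin A1 ->
    o \in rs0 -> o' \in rs1 -> odflt r o = odflt r o' -> o = o'.
  move=> /rep_state[st _ _ _] /rep_state[st1 _ _ _] rA rA1.
  case: o => [x|]; case: o' => [x'|] //= xin xin' E1.
  - by rewrite E1.
  - by rewrite -E1 (state_roots st) ?mem_roots in rA.
  - by rewrite E1 (state_roots st1) ?mem_roots in rA1.
have nBrCh A0 a0 b0 ox oy rs0 t1 t2 ts0 x j r : rep A0 a0 b0 (ox :: oy :: rs0) (t1 :: t2 :: ts0) ->
    r \notin A0 -> x \in A0 -> odflt r ox = x -> odflt r oy = iter j (a0 * b0)%g x -> False.
  move=> rp rA xA Ex Ey; have [st _ _ _] := rep_state rp.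
  have [ar br] := state_fix st rA.
  have yx : iter j (a0 * b0)%g x \in porbit (a0 * b0)%g x by rewrite -permX mem_porbit.
  have xr : x != r by apply: contraNneq rA => <-.
  have yr : iter j (a0 * b0)%g x != r.
    apply: contraNneq xr => yr; move: yx.
    by rewrite yr porbit_fix ?permM ?ar // eq_sym.
  case: ox Ex st rp => [w|] /= Ex st rp; last by rewrite Ex eqxx in xr.
  case: oy Ey st rp => [w'|] /= Ey st rp; last by rewrite -Ey eqxx in yr.
  rewrite -[Some w :: _]/([:: Some w] ++ Some w' :: rs0) in st.
  have := @state_root_sep _ _ _ _ _ _ w' w st; rewrite !inE !eqxx Ex Ey yx.
  by move/(_ isT isT).
have fixr A0 a0 b0 rs0 ts0 r : rep A0 a0 b0 rs0 ts0 -> r \notin A0 -> a0 r = r /\ b0 r = r.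
  by move=> /rep_state[st _ _ _]; apply: (state_fix st).
have rootA A0 a0 b0 x rs0 ts0 : rep A0 a0 b0 (Some x :: rs0) ts0 -> x \in A0.
  by move=> /rep_state[st _ _ _]; apply: (state_roots st); rewrite mem_roots inE eqxx.
elim=> {A a b rs ts} [|A a b rs ts rp IH|A a b ox oy rs t1 t2 ts r rp IH rA
    |A a b x rs t ts r j rp IH rA jt].
- by case=> [|[|t1 t2|t j] ts] // /rep_inv; [case=> ? [] | case=> ?[?[?[?[?[?[?[]]]]]]] | case=> ?[?[?[?[?[?[]]]]]]].
- case=> [|[|t1 t2|t j] ts'] /rep_inv; [by case | | by case=> ?[?[?[?[?[?[?[]]]]]]] | by case=> ?[?[?[?[?[?[]]]]]]].
  by case=> rs1 [[<-] /IH ->].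
- case=> [|[|t1' t2'|t j] ts'] /rep_inv; [by case | by case=> ? [] | | ].
    case=> A1 [a1 [b1 [ox1 [oy1 [rs1 [r1 [[<- <-] rA1 EA [Ea Eb] rp1]]]]]]].
    have [ar br] := fixr _ _ _ _ _ _ rp rA; have [ar1 br1] := fixr _ _ _ _ _ _ rp1 rA1.
    have [EA' Ea' Eb' Ex Ey] := insertion_inj rA rA1 ar ar1 br br1 EA Ea Eb.
    subst A1 a1 b1.
    have Ex' : ox = ox1 by apply: (notr _ _ _ _ _ _ _ _ _ _ _ _ _ rp rp1 rA rA1 _ _ Ex);
      rewrite !inE eqxx.
    have Ey' : oy = oy1 by apply: (notr _ _ _ _ _ _ _ _ _ _ _ _ _ rp rp1 rA rA1 _ _ Ey);
      rewrite !inE eqxx orbT.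
    by subst ox1 oy1; have [-> -> ->] := IH _ rp1.
  case=> A1 [a1 [b1 [x1 [rs1 [r1 [[<- <-] rA1 EA [Ea Eb] rp1]]]]]].
  have [ar br] := fixr _ _ _ _ _ _ rp rA; have [ar1 br1] := fixr _ _ _ _ _ _ rp1 rA1.
  have [EA' Ea' Eb' Ex Ey] := insertion_inj rA rA1 ar ar1 br br1 EA Ea Eb.
  subst A1 a1 b1.
  by case: (nBrCh _ _ _ _ _ _ _ _ _ _ _ _ rp rA (rootA _ _ _ _ _ _ rp1) Ex Ey).
- have rpC := rep_Ch rp rA jt.
  case=> [|[|t1' t2'|t' j'] ts'] /[dup] rpC' /rep_inv; [by case | by case=> ? [] | | ].
    case=> A1 [a1 [b1 [ox1 [oy1 [rs1 [r1 [[<- <-] rA1 EA [Ea Eb] rp1]]]]]]].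
    have [ar br] := fixr _ _ _ _ _ _ rp rA; have [ar1 br1] := fixr _ _ _ _ _ _ rp1 rA1.
    have [EA' Ea' Eb' Ex Ey] := insertion_inj rA rA1 ar ar1 br br1 EA Ea Eb.
    subst A1 a1 b1.
    by case: (nBrCh _ _ _ _ _ _ _ _ _ _ _ _ rp1 rA (rootA _ _ _ _ _ _ rp) (esym Ex) (esym Ey)).
  case=> A1 [a1 [b1 [x1 [rs1 [r1 [[<- <-] rA1 EA [Ea Eb] rp1]]]]]].
  have [ar br] := fixr _ _ _ _ _ _ rp rA; have [ar1 br1] := fixr _ _ _ _ _ _ rp1 rA1.
  have [EA' Ea' Eb' Ex Ey] := insertion_inj rA rA1 ar ar1 br br1 EA Ea Eb.
  subst A1 a1 b1 x1; have [-> ->] := IH _ rp1.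
  have [_ [d1 _] _ _] := rep_state rpC; have [_ [d2 _] _ _] := rep_state rpC'.
  by rewrite -d1 d2.
Qed.

Lemma rep_hiso psi A a b rs A' a' b' rs' ts ts' :
  rep A a b rs ts -> rep A' a' b' rs' ts' -> hiso psi A a b rs A' a' b' rs' -> ts = ts'.
Proof.
move=> rp rp' [hA ha hb hr]; have := rep_conj psi rp; rewrite hr.
have -> : psi @: A = A'.
  by apply/setP=> z; rewrite -[z](permKV psi) hA (mem_imset _ _ perm_inj).
have cj (s s' : {perm E}) : (forall z, psi (s z) = s' (psi z)) -> (s ^ psi)%g = s'.
  by move=> hs; apply/permP=> z; rewrite -[z](permKV psi) permJ hs.
by rewrite (cj _ _ ha) (cj _ _ hb) => /rep_det/(_ _ rp').
Qed.

End Uniqueness.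

(** * Bipartite maps as hypermaps *)

(** The inverse of [s] is one of its powers. *)
Lemma perm_closed (T : finType) (s : {perm T}) (f : T -> bool) :
  (forall z, f z -> f (s z)) -> forall z, f (s z) = f z.
Proof.
move=> fs z; apply/idP/idP => [|/fs //].
have fsi i w : f w -> f ((s ^+ i)%g w).
  by elim: i => [|i IH] fw; rewrite ?perm1 // expgSr permM fs // IH.
move=> /(fsi #[s]%g.-1).
by rewrite -[s z]/((s ^+ 1)%g z) -permM -expgD add1n prednK ?order_gt0 // expg_order perm1.
Qed.

Lemma porbit_imset (T T' : finType) (g : T -> T') (s : {perm T}) (t : {perm T'}) x :
  (forall z, g (s z) = t (g z)) -> porbit t (g x) = g @: porbit s x.
Proof.
move=> gs; have E i : (t ^+ i)%g (g x) = g ((s ^+ i)%g x).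
  by elim: i => [|i IH]; rewrite ?perm1 // !expgSr !permM IH gs.
apply/setP=> z; apply/porbitP/imsetP => [[i ->]|[y /porbitP[i ->] ->]].
  by exists ((s ^+ i)%g x); rewrite ?mem_porbit.
by exists i; rewrite E.
Qed.

Lemma card_porbits_conj (T : finType) (g s t : {perm T}) :
  (forall z, g (s z) = t (g z)) -> #|porbits s| = #|porbits t|.
Proof.
move=> gs; rewrite -(card_imset _ (imset_inj (@perm_inj _ g))); apply: eq_card => O.
apply/imsetP/imsetP => [[Q /imsetP[x _ ->] ->]|[x _ ->]].
  by exists (g x); rewrite // (porbit_imset _ gs).
exists (porbit s (g^-1 x)%g); first by apply: imset_f.
by rewrite -(porbit_imset _ gs) permKV.
Qed.

Section HypermapMap.

Variable k : nat.
Notation D := 'I_(k.*2).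
Implicit Types (a b : {perm 'I_k}) (o : option 'I_k).

Lemma card_darts : #|{: 'I_k * bool}| = k.*2.
Proof. by rewrite card_prod card_ord card_bool muln2. Qed.

(* [dart (e, c)] is the half of the edge [e] at its white ([c = true]) or black end. *)
Definition dart (p : 'I_k * bool) : D := cast_ord card_darts (enum_rank p).
Definition undart (d : D) : 'I_k * bool := enum_val (cast_ord (esym card_darts) d).

Lemma dartK : cancel dart undart.
Proof. by move=> p; rewrite /undart /dart cast_ordK enum_rankK. Qed.

Lemma undartK : cancel undart dart.
Proof. by move=> d; rewrite /undart /dart enum_valK cast_ordKV. Qed.

Lemma dartP (P : D -> Prop) : (forall e c, P (dart (e, c))) -> forall d, P d.
Proof. by move=> H d; rewrite -(undartK d); case: (undart d). Qed.

Lemma dart_inj : injective dart. Proof. exact: can_inj dartK. Qed.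

Definition rot a b (p : 'I_k * bool) := (if p.2 then b p.1 else a p.1, p.2).

Lemma rot_inj a b : injective (rot a b).
Proof. by case=> e c [e' c'] [+ Ec] /=; rewrite /= Ec; case: (c') => /perm_inj ->. Qed.

Lemma sigma_inj a b : injective (fun d => dart (rot a b (undart d))).
Proof. by move=> d d' /dart_inj/rot_inj/(can_inj undartK). Qed.

Lemma alpha_inj : injective (fun d => dart ((undart d).1, ~~ (undart d).2)).
Proof.
move=> d d' /dart_inj[E1 /negb_inj E2]; apply: (can_inj undartK).
by rewrite [undart d]surjective_pairing E1 E2 -surjective_pairing.
Qed.

(* The rooted bipartite map whose white (black) vertices are the cycles of [b] ([a]). *)
Definition to_map a b o : rmap k :=
  RMap (perm (@sigma_inj a b)) (perm alpha_inj) (omap (fun r => dart (r, true)) o).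

Lemma sigmaE a b o e c :
  msigma (to_map a b o) (dart (e, c)) = dart (if c then b e else a e, c).
Proof. by rewrite permE dartK. Qed.

Lemma alphaE a b o e c : malpha (to_map a b o) (dart (e, c)) = dart (e, ~~ c).
Proof. by rewrite permE dartK. Qed.

Lemma phiE a b o e c : (malpha (to_map a b o) * msigma (to_map a b o))%g (dart (e, c))
  = dart (if c then a e else b e, ~~ c).
Proof. by rewrite permM alphaE sigmaE; case: c. Qed.

Lemma card_porbits_sigma a b o :
  #|porbits (msigma (to_map a b o))| = #|porbits a| + #|porbits b|.
Proof.
pose g c e := dart (e, c).
have g_inj c : injective (g c) by move=> e e' /dart_inj[].
have gs c e : g c ((if c then b else a) e) = msigma (to_map a b o) (g c e).
  by rewrite sigmaE; case: c.
have Es : porbits (msigma (to_map a b o)) =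
    [set g false @: O | O : {set 'I_k} in porbits a]
    :|: [set g true @: O | O : {set 'I_k} in porbits b].
  apply/setP=> O; rewrite in_setU; apply/imsetP/orP => [[d _ ->]|].
    move: d; apply: dartP => e c; rewrite -[dart (e, c)]/(g c e) (porbit_imset _ (gs c)).
    by case: c; [right | left]; apply: imset_f; apply: imset_f.
  case=> /imsetP[Q /imsetP[e _ ->] ->].
    by exists (g false e); rewrite // (porbit_imset _ (gs false)).
  by exists (g true e); rewrite // (porbit_imset _ (gs true)).
rewrite Es cardsU !(card_imset _ (imset_inj (g_inj _))).
rewrite (_ : _ :&: _ = set0) ?cards0 ?subn0 //; apply/setP=> O; rewrite in_set0 inE.
apply/negP=> /andP[/imsetP[Q /imsetP[e _ ->] ->] /imsetP[Q' _ E1]].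
have : g false e \in g true @: Q' by rewrite -E1 imset_f ?porbit_id.
by case/imsetP=> e' _ /dart_inj.
Qed.

(** Faces alternate white and black darts, and two steps along a face act as [a * b] on the white
    ones. [first_white] gives the first white dart met, so faces are the preimages of the cycles of
    [a * b]. *)
Lemma card_porbits_phi a b o :
  #|porbits (malpha (to_map a b o) * msigma (to_map a b o))%g| = #|porbits (a * b)%g|.
Proof.
have [phi [-> pE]] : exists phi, (malpha (to_map a b o) * msigma (to_map a b o))%g = phi /\
    forall e c, phi (dart (e, c)) = dart (if c then a e else b e, ~~ c).
  by eexists; split=> // e c; rewrite phiE.
have [ab [-> abE]] : exists ab, (a * b)%g = ab /\ forall e, ab e = b (a e).
  by eexists; split=> // e; rewrite permM.
pose first_white (d : D) := if (undart d).2 then (undart d).1 else b (undart d).1.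
pose G (O : {set 'I_k}) : {set D} := [set d | first_white d \in O].
have phi2 e : phi (phi (dart (e, true))) = dart (ab e, true).
  by rewrite !pE abE.
have fw i e : (phi ^+ i.*2)%g (dart (e, true)) = dart ((ab ^+ i)%g e, true).
  elim: i => [|i IH]; first by rewrite !perm1.
  by rewrite doubleS !expgSr !permM IH phi2.
have fwP d : dart (first_white d, true) \in porbit phi d.
  move: d; apply: dartP => e [|] /=; first by rewrite /first_white dartK porbit_id.
  by rewrite /first_white dartK; have := mem_porbit phi 1 (dart (e, false)); rewrite expg1 pE.
have GE e : porbit phi (dart (e, true)) = G (porbit ab e).
  apply/setP=> d; rewrite inE; apply/idP/idP => [din|/porbitP[i Ei]].
    pose Q d := first_white d \in porbit ab e.
    have Qphi d' : Q (phi d') = Q d'.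
      move: d'; apply: dartP => e' [|]; rewrite /Q /first_white pE !dartK //=.
      rewrite -abE -!eq_porbit_mem.
      by have := porbit_perm ab 1 e'; rewrite expg1 => ->.
    by rewrite -[_ \in _]/(Q d) (porbit_inv Qphi din) /Q /first_white dartK porbit_id.
  have := fwP d; rewrite Ei -fw -!eq_porbit_mem porbit_perm eq_sym => /eqP.
  by move=> <-.
have -> : porbits phi = [set G O | O : {set 'I_k} in porbits ab].
  apply/setP=> O; apply/imsetP/imsetP => [[d _ ->]|[Q /imsetP[e _ ->] ->]].
    exists (porbit ab (first_white d)); first exact: imset_f.
    by have := fwP d; rewrite -eq_porbit_mem => /eqP <-; rewrite GE.
  by exists (dart (e, true)); rewrite ?GE.
rewrite card_imset // => O O' /setP EO; apply/setP=> e.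
by have := EO (dart (e, true)); rewrite !inE /first_white dartK.
Qed.

Lemma to_map_planar a b o : 0 < k ->
  is_planar_map (to_map a b o) = (cycles a b == k + 2).
Proof.
move=> k0; rewrite /is_planar_map card_porbits_sigma card_porbits_phi /cycles.
by rewrite eqn0Ngt k0.
Qed.

Lemma state_const a b r f :
  state [set: 'I_k] a b [:: Some r] -> f \in invs a b -> forall z, f z = f r.
Proof.
move=> st fS z; pose f' := [ffun z => f z (+) f r].
have f'S : f' \in invs a b.
  by apply/invsP=> w; rewrite !ffunE; have [-> ->] := invsP _ _ _ fS w.
have : f z (+) f r = false.
  have := state_cover st f'S _ (in_setT z); rewrite [f' z]ffunE; apply.
  by move=> w; rewrite inE => /eqP ->; rewrite ffunE addbb.
by case: (f z) (f r) => [] [].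
Qed.

Lemma to_map_ind a b r (P : D -> bool) :
  state [set: 'I_k] a b [:: Some r] ->
  (forall d, P d -> P (msigma (to_map a b (Some r)) d)) ->
  (forall d, P d -> P (malpha (to_map a b (Some r)) d)) ->
  forall d d', P d -> P d'.
Proof.
move=> st Ps Pa; have Pt e c : P (dart (e, c)) -> P (dart (e, true)).
  by case: c => // /Pa; rewrite alphaE.
pose f := [ffun e => P (dart (e, true))].
have fS : f \in invs a b.
  apply/invsP=> e; rewrite !ffunE.
  split; [apply: (perm_closed (f := fun e => P (dart (e, true)))) => {}e Pe|
          apply: (perm_closed (f := fun e => P (dart (e, true)))) => {}e Pe].
    by apply: (Pt _ false); have := Ps _ (Pa _ Pe); rewrite alphaE sigmaE.
  by have := Ps _ Pe; rewrite sigmaE.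
have cst e e' : f e -> f e'.
  have Er z : f z = f r := state_const st fS z.
  by rewrite !Er.
move=> d d'; move: d; apply: dartP => e c /Pt Pe; move: d'; apply: dartP => e' c'.
have : P (dart (e', true)) by have := cst e e'; rewrite !ffunE; apply.
by case: c' => // /Pa; rewrite alphaE.
Qed.

Lemma comps_const a b (r : 'I_k) :
  (forall f, f \in invs a b -> forall z, f z = f r) -> comps a b = 1.
Proof.
move=> cst; rewrite /comps.
have -> : invs a b = [set [ffun=> false]; [ffun=> true]].
  apply/setP=> f; rewrite in_set2; apply/idP/idP => [/cst Er|]; last first.
    by case/orP=> /eqP ->; apply/invsP => z; rewrite !ffunE.
  by case E1: (f r); apply/orP; [right | left]; apply/eqP/ffunP => z; rewrite ffunE Er E1.
rewrite cards2 (_ : _ != _) //; apply/eqP=> /ffunP/(_ r).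
by rewrite !ffunE.
Qed.

Lemma to_map_rooted a b o : state [set: 'I_k] a b [:: o] ->
  rooted_bipartite_planar_map (to_map a b o).
Proof.
move=> st; have ok : (o == None) = (k == 0).
  case: o st => [r|] st; first by case: r {st} => m; case: (k).
  case: (posnP k) => [-> //|k0]; rewrite eqxx.
  have := state_cover st (f := [ffun=> true]) _ _ (in_setT (Ordinal k0)).
  by rewrite ffunE; apply=> //; apply/invsP => z; rewrite !ffunE.
split; last 1 first.
- exists (fun d => (undart d).2); apply: dartP => e c.
  by rewrite sigmaE alphaE !dartK; split=> //; case: c.
- split.
  + by apply: dartP => e c; rewrite !alphaE negbK.
  + apply: dartP => e c; rewrite alphaE (inj_eq dart_inj) xpair_eqE eqxx /=.
    by case: c.
  + by rewrite -ok; case: (o).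
  + case: o st ok => [r|] st ok d d'; last first.
      have k0 : k = 0 by apply/eqP; rewrite -ok.
      by have := leq_trans (ltn_ord d) (eq_leq (congr1 double k0)).
    apply: (to_map_ind st (P := connect (map_rel (to_map a b (Some r))) d)) (connect0 _ d).
      by move=> x /connect_trans; apply; apply: connect1; rewrite /map_rel eqxx.
    by move=> x /connect_trans; apply; apply: connect1; rewrite /map_rel eqxx orbT.
- case: (posnP k) => [k0|k0]; first by apply/orP; left; apply/eqP.
  rewrite to_map_planar // (state_euler st) card_ord.
  case: o st ok => [r|] st ok; first by rewrite (comps_const (fun f => state_const st (f := f))).
  by rewrite eqxx [RHS]eqn0Ngt k0 in ok.
Qed.

End HypermapMap.

(** * Isomorphisms of maps and of hypermaps *)

Section Isomorphism.

Variable k : nat.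
Notation D := 'I_(k.*2).
Implicit Types (a b : {perm 'I_k}) (o : option 'I_k) (M N : rmap k).

Lemma rmap_iso_trans M N P : rmap_iso M N -> rmap_iso N P -> rmap_iso M P.
Proof.
case=> psi [hs ha hr] [psi' [hs' ha' hr']]; exists (psi * psi')%g; split=> [d|d|].
- by rewrite !permM hs hs'.
- by rewrite !permM ha ha'.
- by rewrite -hr' -hr; case: (mroot M) => //= r; rewrite permM.
Qed.

Lemma rmap_iso_planar M N : rmap_iso M N -> is_planar_map M = is_planar_map N.
Proof.
case=> psi [hs ha _]; rewrite /is_planar_map (card_porbits_conj hs).
by rewrite (@card_porbits_conj _ psi (malpha M * msigma M)%g (malpha N * msigma N)%g) // => d; rewrite !permM hs ha.
Qed.

Lemma connected_const M (T : eqType) (f : D -> T) : is_rooted_map M ->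
  (forall d, f (msigma M d) = f d) -> (forall d, f (malpha M d) = f d) ->
  forall d d', f d = f d'.
Proof.
case=> _ _ _ conn fs fa d d'; have /connectP[p pth ->] := conn d d'.
elim: p d pth => //= x p IH d /andP[dx /IH <-].
by case/orP: dx => /eqP ->.
Qed.

Lemma side_sigma a b o d : (undart (msigma (to_map a b o) d)).2 = (undart d).2.
Proof. by move: d; apply: dartP => e c; rewrite sigmaE !dartK. Qed.

Lemma side_alpha a b o d : (undart (malpha (to_map a b o) d)).2 = ~~ (undart d).2.
Proof. by move: d; apply: dartP => e c; rewrite alphaE !dartK. Qed.

Lemma hiso_to_map (p a b a' b' : {perm 'I_k}) o o' :
  hiso p [set: 'I_k] a b [:: o] [set: 'I_k] a' b' [:: o'] ->
  rmap_iso (to_map a b o) (to_map a' b' o').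
Proof.
case=> _ pa pb [<-]; pose h (d : D) := dart (p (undart d).1, (undart d).2).
have h_inj : injective h.
  move=> d d' /dart_inj[/perm_inj E1 E2]; apply: (can_inj (@undartK _)).
  by rewrite [undart d]surjective_pairing E1 E2 -surjective_pairing.
exists (perm h_inj); split.
- by apply: dartP => e c; rewrite sigmaE !permE /h !dartK /=; case: c; rewrite ?pa ?pb.
- by apply: dartP => e c; rewrite alphaE !permE /h !dartK.
- by case: o => //= r; rewrite permE /h dartK.
Qed.

(** Root darts are always white, so an isomorphism preserves the side of the root, hence by
    connectedness of every dart, and it acts on edges. *)
Lemma to_map_hiso a b a' b' o o' :
  state [set: 'I_k] a b [:: o] -> state [set: 'I_k] a' b' [:: o'] ->
  rmap_iso (to_map a b o) (to_map a' b' o') ->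
  exists p, hiso p [set: 'I_k] a b [:: o] [set: 'I_k] a' b' [:: o'].
Proof.
move=> st st' [psi [hs ha hr]].
case: o st hs ha hr => [r|] st hs ha hr; last first.
  case: o' st' hs ha hr => // st' hs ha hr.
  have k0 : k = 0 by have [[_ _ + _] _ _] := to_map_rooted st; rewrite eqxx => /esym/eqP.
  have noI (z : 'I_k) : False by have := leq_trans (ltn_ord z) (eq_leq k0).
  by exists 1%g; split=> // z; case: (noI z).
have [rt _ _] := to_map_rooted st.
pose F (d : D) := (undart (psi d)).2 (+) (undart d).2.
have undart_eta d : dart ((undart d).1, (undart d).2) = d :> D.
  by rewrite -surjective_pairing undartK.
have F0 d : F d = false.
  have -> : false = F (dart (r, true)).
    case: o' st' hs ha hr => // r' st' hs ha [hr].
    by rewrite /F hr !dartK.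
  apply: (connected_const rt) => {}d.
    by rewrite /F hs !side_sigma.
  by rewrite /F ha !side_alpha addNb addbN negbK.
pose q e := (undart (psi (dart (e, true)))).1.
have qE e c : psi (dart (e, c)) = dart (q e, c).
  have qt : psi (dart (e, true)) = dart (q e, true).
    have := F0 (dart (e, true)); rewrite /F dartK /= addbT => /negbFE E1.
    by rewrite -{2}E1 undart_eta.
  by case: c => //; have := ha (dart (e, true)); rewrite qt !alphaE.
have q_inj : injective q.
  move=> e e' E1; have : psi (dart (e, true)) = psi (dart (e', true)) by rewrite !qE E1.
  by move/perm_inj/dart_inj=> [].
exists (perm q_inj); split=> [z|z|z|].
- by rewrite !in_setT.
- have := hs (dart (z, false)); rewrite sigmaE !qE sigmaE => /dart_inj[].
  by rewrite !permE.
- have := hs (dart (z, true)); rewrite sigmaE !qE sigmaE => /dart_inj[].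
  by rewrite !permE.
- case: o' st' hs ha hr => // r' st' hs ha [] /=.
  by rewrite qE => /dart_inj[<-]; rewrite permE.
Qed.

Lemma state_of_map a b r :
  rooted_bipartite_planar_map (to_map a b (Some r)) ->
  state [set: 'I_k] a b [:: Some r].
Proof.
case=> rt pln _; have k0 : 0 < k := leq_ltn_trans (leq0n r) (ltn_ord r).
have cst f : f \in invs a b -> forall z, f z = f r.
  move=> /invsP fS z.
  have := @connected_const _ _ (fun d => f (undart d).1) rt _ _ (dart (z, true)) (dart (r, true)).
  rewrite !dartK; apply.
    by apply: dartP => e c; rewrite sigmaE !dartK /=; have [] := fS e; case: c.
  by apply: dartP => e c; rewrite alphaE !dartK.
split.
- by move=> z; rewrite in_setT.
- by move=> z _; rewrite in_setT.
- by move=> f fS fr z _; rewrite cst // fr // inE.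
- case=> [|c [|? ?]] // _; exists [ffun=> c]; last by rewrite /= ffunE.
  by apply/invsP=> z; rewrite !ffunE.
- by move: pln; rewrite to_map_planar // card_ord (comps_const cst) => /eqP.
Qed.

(** The colour of the root vertex is named white, and an edge is identified with its white half. The
    black rotation is read on white halves through [malpha], which also shows that they are half of
    all darts. *)
Lemma to_map_surj M : rooted_bipartite_planar_map M -> 0 < k ->
  exists a b r, rmap_iso (to_map a b (Some r)) M.
Proof.
case=> [[al1 al2 rt conn] _ [c cP]] k0.
case Er: (mroot M) rt => [root|] rt; last by rewrite eqn0Ngt k0 in rt.
have cs d : c (msigma M d) = c d by case: (cP d).
have ca d : c (malpha M d) = ~~ c d by case: (cP d) => _; case: (c _) (c d) => [] [].
pose W := [set d | c d == c root].
have cardW : #|W| = k.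
  have : #|~: W| = #|W|.
    rewrite -(card_imset (mem W) (@perm_inj _ (malpha M))); apply: eq_card => d.
    rewrite -{2}(al1 d) (mem_imset _ _ perm_inj) !inE ca.
    by case: (c d) (c root) => [] [].
  by have := cardsC W; rewrite card_ord; lia.
pose H (e : 'I_k) : D := enum_val (cast_ord (esym cardW) e).
have HW e : c (H e) = c root by have := enum_valP (cast_ord (esym cardW) e); rewrite inE => /eqP.
have H_inj : injective H by move=> e e' /enum_val_inj/cast_ord_inj.
pose h (d : D) := if (undart d).2 then H (undart d).1 else malpha M (H (undart d).1).
have ch d : c (h d) = (if (undart d).2 then c root else ~~ c root).
  by rewrite /h; case: ifP => _; rewrite ?ca HW.
have h_inj : injective h.
  move=> d d' E1; have := congr1 c E1; rewrite !ch => E2.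
  have E3 : (undart d).2 = (undart d').2.
    by case: (undart d).2 (undart d').2 (c root) E2 => [] [] [].
  apply: (can_inj (@undartK _)); rewrite [undart d]surjective_pairing E3.
  have : H (undart d).1 = H (undart d').1.
    by move: E1; rewrite /h E3; case: ifP => // _ /perm_inj.
  by move=> /H_inj ->; rewrite -surjective_pairing.
pose psi := perm h_inj; pose K d := (undart ((psi^-1)%g d)).1.
have HK d : c d = c root -> H (K d) = d.
  move=> cd; have := permKV psi d; rewrite permE /h -/(K d).
  by case: ifP => // _ E1; move: cd; rewrite -E1 ca HW; case: (c root).
have b_inj : injective (fun e => K (msigma M (H e))).
  move=> e e' E1; apply: H_inj; apply: (@perm_inj _ (msigma M)).
  by rewrite -[LHS]HK ?cs ?HW // E1 HK ?cs ?HW.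
have cas e : c (malpha M (msigma M (malpha M (H e)))) = c root.
  by rewrite ca cs ca HW negbK.
have a_inj : injective (fun e => K (malpha M (msigma M (malpha M (H e))))).
  move=> e e' E1; apply: H_inj; do 3!apply: perm_inj.
  by rewrite -[LHS]HK // E1 HK.
exists (perm a_inj), (perm b_inj), (K root), psi; split.
- apply: dartP => e [|]; rewrite sigmaE ![psi _]permE /h !dartK /= permE HK //.
  by rewrite cs HW.
- by apply: dartP => e [|]; rewrite alphaE ![psi _]permE /h !dartK //= al1.
- by rewrite Er /= permE /h dartK /= HK.
Qed.

Lemma rooted_bipartite_planar_iso M N : rmap_iso M N ->
  rooted_bipartite_planar_map N -> rooted_bipartite_planar_map M.
Proof.
move=> iso [[al1 al2 rt conn] pln [c cP]]; rewrite -(rmap_iso_planar iso) in pln.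
case: iso => psi [hs ha hr]; split=> //; last first.
  by exists (c \o psi) => d /=; rewrite hs ha.
split.
- by move=> d; apply: (@perm_inj _ psi); rewrite !ha al1.
- by move=> d; rewrite -(inj_eq (@perm_inj _ psi)) ha al2.
- by rewrite -rt -hr; case: (mroot M).
- move=> d d'; have /connectP[p] := conn (psi d) (psi d').
  elim: p d => [|x p IH] d /=; first by move=> _ /perm_inj ->; apply: connect0.
  case/andP=> dx pth El; have [y Ey] : exists y, x = psi y by exists ((psi^-1)%g x); rewrite permKV.
  rewrite Ey in dx pth El; apply: connect_trans (connect1 _) (IH y pth El).
  by move: dx; rewrite /map_rel -hs -ha !(inj_eq perm_inj).
Qed.

Lemma map_rep M : rooted_bipartite_planar_map M ->
  exists a b o t, rep [set: 'I_k] a b [:: o] [:: t] /\ rmap_iso (to_map a b o) M.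
Proof.
move=> HM; case: (posnP k) => [k0|k0].
  have noI (z : 'I_k) : False by have := leq_trans (ltn_ord z) (eq_leq k0).
  have noD (d : D) : False by have := leq_trans (ltn_ord d) (eq_leq (congr1 double k0)).
  exists 1%g, 1%g, None, Em; split.
    have -> : [set: 'I_k] = set0 by apply/setP=> z; case: (noI z).
    by do 2!constructor.
  exists 1%g; split=> [d|d|]; try by case: (noD d).
  by case: HM => [[_ _ + _] _ _]; rewrite [k == 0](introT eqP k0) => /eqP ->.
have [a [b [r iso]]] := to_map_surj HM k0.
have st := state_of_map (rooted_bipartite_planar_iso iso HM).
have [ts rp] := state_rep st; have [_ + _ _] := rep_state rp.
by case: ts rp => [|t [|? ?]] // rp _; exists a, b, (Some r), t.
Qed.

End Isomorphism.

(* A bijection between 3-connected planar linear normal terms with n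
   variables and isomorphism classes of rooted bipartite planar maps
   with n - 2 edges. *)
Theorem theorem1 (n : nat) (hn : 2 <= n) :
  exists f : lterm -> rmap (n - 2),
    [/\ forall t, good_term n t -> rooted_bipartite_planar_map (f t),
        forall t t', good_term n t -> good_term n t' ->
          rmap_iso (f t) (f t') -> t = t' &
        forall M : rmap (n - 2), rooted_bipartite_planar_map M ->
          exists t, good_term n t /\ rmap_iso (f t) M].
Proof.
(* A tree gives a map only up to isomorphism, so a representative is chosen by [epsilon]. As the
   tree has n - 2 edges, its hypermap fills the whole type of darts. *)
pose spec t (M : rmap (n - 2)) := exists a b o,
  M = to_map a b o /\ rep [set: 'I_(n - 2)] a b [:: o] [:: term_tree t].
have ex t : good_term n t -> exists M, spec t M.
  move=> /(term_treeP hn)[vt st].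
  have [|A [a [b [o [rp cA]]]]] := rep_exists vt (rep_nil 'I_(n - 2)).
    by rewrite cards0 addn0 st card_ord.
  have EA : A = [set: _].
    by apply/eqP; rewrite eqEcard subsetT cardsT card_ord cA cards0 addn0 st leqnn.
  by exists (to_map a b o), a, b, o; rewrite -EA.
pose M0 : rmap (n - 2) := RMap 1%g 1%g None.
exists (fun t => epsilon (inhabits M0) (spec t)).
have fP t : good_term n t -> spec t (epsilon (inhabits M0) (spec t)).
  by move=> /ex; apply: epsilon_spec.
split.
- by move=> t /fP[a [b [o [-> /rep_state[st _ _ _]]]]]; apply: to_map_rooted.
- move=> t t' gt gt'; have [a [b [o [-> rp]]]] := fP t gt.
  have [a' [b' [o' [-> rp']]]] := fP t' gt'.
  have [st _ _ _] := rep_state rp; have [st' _ _ _] := rep_state rp'.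
  case/(to_map_hiso st st')=> p /(rep_hiso rp rp')[E].
  exact: term_tree_inj hn gt gt' E.
- move=> M /map_rep[a [b [o [x [rp iso]]]]].
  have [_ _ vx sx] := rep_state rp.
  have [t gt Et] : exists2 t, good_term n t & term_tree t = x.
    apply: term_tree_surj => //; first by case/andP: vx.
    by move: sx; rewrite cardsT card_ord /= addn0.
  exists t; split=> //; have [a' [b' [o' [-> rp']]]] := fP t gt.
  rewrite Et in rp'; have [p hp] := rep_iso rp' rp.
  exact: rmap_iso_trans (hiso_to_map hp) iso.
Qed.
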